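(* Let $\Gamma$ be a connected simplicial graph which is tree-graded with respect to a collection of pieces $\mathcal{P}=\{\Gamma_i\}_{i\in I}$, with shortest path metric $d_\Gamma$ on its vertex set. Let $p\geq 1$. Suppose we are given a concave function $\rho':\mathbb{N}\to\mathbb{R}_{\geq 0}$ and maps $\psi_i:V(\Gamma_i)\to\ell^p(X_i)$ (for sets $X_i$) such that for all $i$ and all $x,y\in V(\Gamma_i)$, \[ \rho'(d_\Gamma(x,y))\leq\|\psi_i(x)-\psi_i(y)\|_p\leq d_\Gamma(x,y). \] If $p=1$, there is a map $\phi$ from $V(\Gamma)$ into an $\ell^1$ space with $\rho'(d_\Gamma(x,y))\preceq\|\phi(x)-\phi(y)\|_1\preceq d_\Gamma(x,y)$ for all vertices $x,y$. If $p>1$, then for every function $f:\mathbb{N}\to\mathbb{R}_{\geq 0}$ satisfying $(C_p)$ there is a map $\phi$ from $V(\Gamma)$ into an $\ell^p$ space with \[ \rho(d_\Gamma(x,y))\preceq\|\phi(x)-\phi(y)\|_p\preceq d_\Gamma(x,y) \] for all vertices $x,y$, where $\rho(n)=\min\{\rho'(n),f(n)\}$.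
   Context: A connected simplicial graph $\Gamma$ is tree-graded with respect to a collection $\{\Gamma_i\}_{i\in I}$ of non-empty connected subgraphs if (1) every vertex and every simple loop of $\Gamma$ is contained in some $\Gamma_i$, and (2) for $i\neq j$, $\Gamma_i\not\subseteq\Gamma_j$ and $|V(\Gamma_i)\cap V(\Gamma_j)|\leq 1$. No countability is assumed; $\ell^p(S)$ for an arbitrary set $S$ denotes countably supported functions $S\to\mathbb{R}$ with finite $\ell^p$ norm. A function $f:\mathbb{N}\to\mathbb{R}_{\geq0}$ is concave if it is non-decreasing and $f(n+m)-f(n)\leq f(n)-f(n-m)$ for $n\geq m$; it satisfies $(C_p)$ if it is concave and $\sum_{n\geq1}\frac1n\left(\frac{f(n)}{n}\right)^p<\infty$. $A\preceq B$ means $A\leq CB+C$ for a constant $C$ independent of $x,y$. *)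

(* Defs.v *)
From HB Require Import structures.
From mathcomp Require Import all_boot all_order all_algebra.
From mathcomp Require Import all_classical all_reals all_analysis.
Set Implicit Arguments. Unset Strict Implicit. Unset Printing Implicit Defensive.
Import Order.TTheory GRing.Theory Num.Theory.
Local Open Scope classical_set_scope.
Local Open Scope ring_scope.

Inductive walk {V : Type} (adj : V -> V -> Prop) : V -> V -> nat -> Prop :=
| walk_nil x : walk adj x x 0
| walk_cons x y z n : adj x y -> walk adj y z n -> walk adj x z n.+1.

Definition simplicial {V : Type} (adj : V -> V -> Prop) : Prop :=
  (forall x y, adj x y -> adj y x) /\ (forall x, ~ adj x x).

Definition graph_connected {V : Type} (adj : V -> V -> Prop) : Prop :=
  forall x y, exists n, walk adj x y n.

(* shortest path metric (0 if no path exists, irrelevant for connected graphs) *)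
Definition gdist {V : Type} (adj : V -> V -> Prop) (x y : V) : nat :=
  xget 0%N [set n | walk adj x y n /\ forall m, walk adj x y m -> (n <= m)%N].

Definition is_subgraph {V : Type} (adj : V -> V -> Prop)
  (Vs : set V) (Es : V -> V -> Prop) : Prop :=
  (forall x y, Es x y -> adj x y /\ Vs x /\ Vs y) /\
  (forall x y, Es x y -> Es y x).

Definition ne_connected_subgraph {V : Type} (adj : V -> V -> Prop)
  (Vs : set V) (Es : V -> V -> Prop) : Prop :=
  is_subgraph adj Vs Es /\ (exists v, Vs v) /\
  (forall x y, Vs x -> Vs y -> exists n, walk Es x y n).

Definition simple_loop {V : Type} (adj : V -> V -> Prop) (k : nat) (c : nat -> V)
  : Prop :=
  (3 <= k)%N /\
  (forall a b, (a < k)%N -> (b < k)%N -> c a = c b -> a = b) /\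
  (forall a, (a < k)%N -> adj (c a) (c ((a.+1) %% k)%N)).

Definition loop_in {V : Type} (Vs : set V) (Es : V -> V -> Prop)
  (k : nat) (c : nat -> V) : Prop :=
  (forall a, (a < k)%N -> Vs (c a)) /\
  (forall a, (a < k)%N -> Es (c a) (c ((a.+1) %% k)%N)).

Definition subgraph_le {V : Type} (V1 : set V) (E1 : V -> V -> Prop)
  (V2 : set V) (E2 : V -> V -> Prop) : Prop :=
  V1 `<=` V2 /\ (forall x y, E1 x y -> E2 x y).

Definition tree_graded {V I : Type} (adj : V -> V -> Prop)
  (Vp : I -> set V) (Ep : I -> V -> V -> Prop) : Prop :=
  (forall i, ne_connected_subgraph adj (Vp i) (Ep i)) /\
  (forall v, exists i, Vp i v) /\
  (forall k c, simple_loop adj k c -> exists i, loop_in (Vp i) (Ep i) k c) /\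
  (forall i j, i <> j ->
     ~ subgraph_le (Vp i) (Ep i) (Vp j) (Ep j) /\
     (forall a b, Vp i a -> Vp j a -> Vp i b -> Vp j b -> a = b)).

Definition lp_sum {R : realType} {S : choiceType} (p : R) (f : S -> R) : \bar R :=
  \esum_(s in [set: S]) ((`|f s| `^ p)%:E).

Definition in_lp {R : realType} {S : choiceType} (p : R) (f : S -> R) : Prop :=
  countable [set s | f s != 0] /\ (lp_sum p f < +oo)%E.

Definition lp_norm {R : realType} {S : choiceType} (p : R) (f : S -> R) : R :=
  (fine (lp_sum p f)) `^ p^-1.

Definition concave_fun {R : realType} (f : nat -> R) : Prop :=
  (forall n, 0 <= f n) /\
  (forall n m, (n <= m)%N -> f n <= f m) /\
  (forall n m, (m <= n)%N -> f (n + m)%N - f n <= f n - f (n - m)%N).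

Definition Cp_cond {R : realType} (p : R) (f : nat -> R) : Prop :=
  concave_fun f /\
  (\sum_(1 <= n <oo) (((n%:R)^-1 * (f n / n%:R) `^ p)%:E) < +oo)%E.

Definition coarse_le {V : Type} {R : realType} (A B : V -> V -> R) : Prop :=
  exists C : R, forall x y, A x y <= C * B x y + C.

(* Main.v *)
(* Fix a root e. The pieces, together with the edges lying in no piece, form a family of
   blocks: two blocks share at most one vertex, and an excursion outside a block returns to
   the vertex where it left, since otherwise it would close up to a simple loop. Hence every
   vertex x <> e lies below a unique gate, the point nearest to e of the block through which
   the geodesics from x to e leave x, and distances to e add up along the chain of
   successive gates.

   For each block B let phi(x) contain psi_B of the nearest point of B to x. This map is
   Lipschitz; as the l^1 norm adds up over the blocks between x and y, subadditivity of rho'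
   settles p = 1. For p > 1 one long block on the way from x to y still suffices, but many
   short ones do not. So phi also gets, for each ancestor u of x at distance l below its gate
   and each k < l, a coordinate depending on t = d(u, x) with slope f(n) / n^(1 + 1/p) at
   n = t + 1, vanishing for t <= k. Up to a factor 4 the increments are the values of that
   function at the distinct numbers t + k + 1, so (C_p) makes the map Lipschitz, while short
   blocks over a total distance D contribute f(D), up to a constant, to the norm. *)

Require Import Defs.
From HB Require Import structures.
From mathcomp Require Import all_boot all_order all_algebra.
From mathcomp Require Import finmap.
From mathcomp Require Import all_classical all_reals all_analysis.
From mathcomp Require Import zify ring lra.
Import Order.TTheory GRing.Theory Num.Theory.
Local Open Scope classical_set_scope.
Local Open Scope ring_scope.

Set Implicit Arguments.
Unset Strict Implicit.
Unset Printing Implicit Defensive.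

(** * Concave functions on the natural numbers *)

Section concave_functions.
Variable R : realType.
Implicit Types f : nat -> R.

(** Increments of [f] do not increase, so adding 1 to [m + n] gains at most what adding 1 to [n]
    gains; the induction starts from [0 <= f 0]. *)
Lemma concave_fun_subadd f m n : concave_fun f -> f (m + n)%N <= f m + f n.
Proof.
move=> [f0 [f_nd f_conc]].
have step k l : (k <= l)%N -> f l.+1 - f l <= f k.+1 - f k.
  elim: l => [|l IHl]; first by rewrite leqn0 => /eqP ->.
  rewrite leq_eqVlt => /predU1P[-> //|/IHl]; apply: le_trans.
  by have := f_conc l.+1 1%N isT; rewrite addn1 subn1.
elim: n => [|n IHn]; first by rewrite addn0 lerDl.
have := step n (m + n)%N (leq_addl _ _); rewrite addnS.
by move: IHn; lra.
Qed.

Lemma concave_fun_mulSn f k n : concave_fun f -> f (k.+1 * n)%N <= k.+1%:R * f n.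
Proof.
move=> fc; elim: k => [|k IHk]; first by rewrite !mul1n mul1r.
rewrite mulSn (le_trans (concave_fun_subadd _ _ fc))//.
by rewrite [in leRHS]mulrS mulrDl mul1r lerD2l.
Qed.

(** The increment after [k] is at most the mean of the [k] earlier ones, which is at most [f k / k]
    because [0 <= f 0]. *)
Lemma concave_fun_slope f m n : concave_fun f -> (0 < m)%N -> (m <= n)%N ->
  f n / n%:R <= f m / m%:R.
Proof.
move=> [f0 [f_nd f_conc]] m0 mn.
have step k : k%:R * (f k.+1 - f k) <= f k.
  elim: k => [|k IHk]; first by rewrite mul0r.
  have := f_conc k.+1 1%N isT; rewrite addn1 subn1 /= => fk.
  have : k.+1%:R * (f k.+2 - f k.+1) <= k.+1%:R * (f k.+1 - f k) by rewrite ler_wpM2l.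
  by move=> /le_trans; apply; rewrite -natr1 mulrDl mul1r; move: IHk; lra.
elim: n mn => [|n IHn]; first by rewrite leqNgt m0.
rewrite leq_eqVlt => /predU1P[-> //|]; rewrite ltnS => mn.
apply: le_trans (IHn mn).
have n0 : (0 < n)%N := leq_trans m0 mn.
rewrite ler_pdivrMr ?ltr0n// mulrAC ler_pdivlMr ?ltr0n//.
by have := step n; rewrite -natr1; lra.
Qed.

End concave_functions.

(** * Minkowski's inequality and countability of supports *)

Section lp_sums.
Variables (R : realType) (p : R).
Hypothesis p1 : 1 <= p.

Let p0 : 0 < p. Proof. exact: lt_le_trans p1. Qed.

(** Convexity of the power [p] at [|u| / a] and [|v| / b], with weights proportional to [a] and
    [b]. *)
Lemma convex_powR_norm (a b u v : R) : 0 < a -> 0 < b ->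
  `|u + v| `^ p <= (a + b) `^ p * (a / (a + b) * (`|u| `^ p / a `^ p)
                                   + b / (a + b) * (`|v| `^ p / b `^ p)).
Proof.
move=> a0 b0; have ab0 : 0 < a + b by rewrite addr_gt0.
have t0 : 0 <= a / (a + b) by rewrite divr_ge0 ?ltW.
have t1 : a / (a + b) <= 1 by rewrite ler_pdivrMr// mul1r lerDl ltW.
have /(_ (Itv01 t0 t1) (`|u| / a) (`|v| / b)) := @convex_powR R p p1.
have ua0 : 0 <= `|u| / a by apply: divr_ge0 => //; exact: ltW.
have vb0 : 0 <= `|v| / b by apply: divr_ge0 => //; exact: ltW.
rewrite !inE /= !in_itv /= !andbT => /(_ ua0 vb0); rewrite [X in X `^ p]convRE /=.
have onem_ab : unstable.onem (a / (a + b)) = b / (a + b).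
  by rewrite /unstable.onem; field; rewrite gt_eqF.
rewrite onem_ab.
have powV (x c : R) : 0 <= x -> 0 < c -> (x / c) `^ p = x `^ p / c `^ p.
  move=> x0 c0; rewrite powRM ?invr_ge0 ?(ltW c0)//; congr (_ * _).
  have -> : c^-1 = c `^ (-1) by rewrite powR_inv1// ltW.
  by rewrite -powRrM mulN1r powRN.
have -> : a / (a + b) * (`|u| / a) + b / (a + b) * (`|v| / b)
          = (`|u| + `|v|) / (a + b) by field; rewrite !gt_eqF.
rewrite !powV ?addr_ge0// ler_pdivrMr ?powR_gt0// [leRHS]mulrC => le_uv.
rewrite convRE /= onem_ab in le_uv.
apply: le_trans le_uv; apply: (ge0_ler_powR (ltW p0)).
- by rewrite nnegrE.
- by rewrite nnegrE addr_ge0.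
- exact: ler_normD.
Qed.

Lemma lp_sum_ge0 (S : choiceType) (f : S -> R) : (0 <= lp_sum p f)%E.
Proof. by apply: esum_ge0 => s _; rewrite lee_fin powR_ge0. Qed.

Lemma eq_lp_sum (S : choiceType) (f g : S -> R) : f =1 g -> lp_sum p f = lp_sum p g.
Proof. by move=> fg; apply: eq_esum => s _; rewrite fg. Qed.

Lemma lp_sum0 (S : choiceType) (f : S -> R) : (forall s, f s = 0) -> lp_sum p f = 0%E.
Proof. by move=> f0; apply: esum1 => s _; rewrite f0 normr0 powR0 ?gt_eqF. Qed.

Lemma lp_sum_sym (S : choiceType) (f g : S -> R) :
  lp_sum p (f \- g) = lp_sum p (g \- f).
Proof. by apply: eq_esum => s _ /=; rewrite distrC. Qed.

(** Minkowski's inequality, phrased with positive bounds instead of norms: [a] and [b] then serve as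
    weights in [convex_powR_norm], applied on each finite set of coordinates. *)
Lemma lp_sumD (S : choiceType) (f g : S -> R) (a b : R) : 0 < a -> 0 < b ->
  (lp_sum p f <= (a `^ p)%R%:E)%E -> (lp_sum p g <= (b `^ p)%R%:E)%E ->
  (lp_sum p (f \+ g)%R <= ((a + b) `^ p)%R%:E)%E.
Proof.
move=> a0 b0 fa gb.
have ab0 : 0 < a + b by rewrite addr_gt0.
apply: ge_ereal_sup => _ [D [finD _] <-].
have fD : (\sum_(s \in D) (`|f s| `^ p)%R%:E <= (a `^ p)%R%:E)%E.
  by apply: le_trans fa; apply: ereal_sup_ubound; exists D.
have gD : (\sum_(s \in D) (`|g s| `^ p)%R%:E <= (b `^ p)%R%:E)%E.
  by apply: le_trans gb; apply: ereal_sup_ubound; exists D.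
rewrite fsbig_finite//= sumEFin lee_fin in fD.
rewrite fsbig_finite//= sumEFin lee_fin in gD.
rewrite fsbig_finite//= sumEFin lee_fin.
apply: le_trans.
  by apply: ler_sum => s _; exact: convex_powR_norm (f s) (g s) a0 b0.
rewrite -mulr_sumr big_split/= -!mulr_sumr -!mulr_suml.
rewrite -[leRHS]mulr1 ler_wpM2l ?powR_ge0//.
have -> : 1 = a / (a + b) * 1 + b / (a + b) * 1 by rewrite !mulr1; field; rewrite gt_eqF.
by apply: lerD; apply: ler_wpM2l;
  rewrite ?divr_ge0 1?(ltW a0) 1?(ltW b0) 1?(ltW ab0)// ler_pdivrMr ?powR_gt0// mul1r.
Qed.

Lemma lp_sumB_lty (S : choiceType) (f g : S -> R) :
  (lp_sum p f < +oo)%E -> (lp_sum p g < +oo)%E -> (lp_sum p (f \- g)%R < +oo)%E.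
Proof.
have bound (h : S -> R) : (lp_sum p h < +oo)%E ->
    exists2 a : R, 0 < a & (lp_sum p h <= (a `^ p)%R%:E)%E.
  move=> hy; have h_fin : lp_sum p h \is a fin_num by rewrite ge0_fin_numE ?lp_sum_ge0.
  have h0 : 0 <= fine (lp_sum p h) by rewrite fine_ge0 ?lp_sum_ge0.
  (* The base is at least 1, so raising it to the power [p >= 1] does not decrease it. *)
  exists (1 + fine (lp_sum p h)); first by rewrite ltr_pwDl.
  rewrite -[leLHS]fineK// lee_fin (@le_trans _ _ (1 + fine (lp_sum p h)))//.
    by rewrite lerDr.
  by apply: le1r_powR; rewrite ?lerDl.
have NE (h : S -> R) : lp_sum p (\- h) = lp_sum p h.
  by apply: eq_esum => s _ /=; rewrite normrN.
move=> /bound[a a0 fa] /bound[b b0]; rewrite -NE => gb.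
by rewrite (le_lt_trans (lp_sumD a0 b0 fa gb))// ltry.
Qed.

(** A finite sum leaves only finitely many coordinates with [|f s|^p >= 1 / (n + 1)], and the
    support is the union of these sets over [n]. *)
Lemma lp_sum_in_lp (S : choiceType) (f : S -> R) : (lp_sum p f < +oo)%E -> in_lp p f.
Proof.
move=> fy; split => //.
pose A n := [set s | n.+1%:R^-1 <= `|f s| `^ p].
have -> : [set s | f s != 0] = \bigcup_n A n.
  rewrite eqEsubset; split => s /=.
    rewrite -normr_gt0 => fs0; have fp0 : 0 < `|f s| `^ p by rewrite powR_gt0.
    have := archimedean.Num.Theory.truncnS_gt ((`|f s| `^ p)^-1).
    set n := Num.truncn _ => nf; exists n => //=.
    by rewrite /A /= -[leRHS]invrK lef_pV2 ?posrE ?invr_gt0// ltW.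
  move=> [n _]; rewrite /A /=; apply: contraTneq => ->.
  by rewrite normr0 powR0 ?gt_eqF// -ltNge invr_gt0.
apply: bigcup_countable => // n _; apply: finite_set_countable.
apply: contrapT => infA.
have f_fin : lp_sum p f \is a fin_num by rewrite ge0_fin_numE ?lp_sum_ge0.
set M := fine (lp_sum p f).
(* More than [M * (n + 1)] terms of size at least [1 / (n + 1)] would exceed the total [M]. *)
pose N := (Num.truncn (M * n.+1%:R)).+1.
have MN : M * n.+1%:R < N%:R := archimedean.Num.Theory.truncnS_gt _.
have [B BA NB] := infinite_set_fset N infA.
have : (\sum_(s <- B) (`|f s| `^ p)%R%:E <= lp_sum p f)%E.
  by apply: ereal_sup_ubound; exists [set` B] => //; rewrite fsbig_finite//= set_fsetK.
rewrite -[lp_sum p f]fineK// -/M sumEFin lee_fin; apply/negP; rewrite -ltNge.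
apply: (@lt_le_trans _ _ (\sum_(s <- B) n.+1%:R^-1)).
  rewrite big_const_seq count_predT iter_addr_0 -[ltRHS]mulr_natl ltr_pdivlMr ?ltr0n//.
  by rewrite (lt_le_trans MN)// ler_nat.
by rewrite big_seq [leRHS]big_seq; apply: ler_sum => s sB; exact: BA.
Qed.

End lp_sums.

(** * Norms versus sums of powers, and sums over disjoint unions *)

Section lp_norms.
Variables (R : realType) (p : R) (p1 : 1 <= p).

Let p0 : 0 < p. Proof. exact: lt_le_trans p1. Qed.

Let powRK (a : R) : 0 <= a -> (a `^ p) `^ p^-1 = a.
Proof. by move=> a0; rewrite -powRrM divff ?gt_eqF// powRr1. Qed.

Let powRVK (a : R) : 0 <= a -> (a `^ p^-1) `^ p = a.
Proof. by move=> a0; rewrite -powRrM mulVf ?gt_eqF// powRr1. Qed.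

Lemma lp_norm_le (S : choiceType) (f : S -> R) (a : R) : 0 <= a ->
  (lp_sum p f <= (a `^ p)%R%:E)%E -> lp_norm p f <= a.
Proof.
move=> a0 fa; have f0 := lp_sum_ge0 p f.
have f_fin : lp_sum p f \is a fin_num.
  by rewrite ge0_fin_numE// (le_lt_trans fa)// ltry.
rewrite -[leRHS](powRK a0) ge0_ler_powR ?invr_ge0 ?(ltW p0) ?nnegrE ?fine_ge0//.
  exact: powR_ge0.
by rewrite -lee_fin fineK.
Qed.

(** Finiteness matters here: [fine] sends [+oo] to 0, so a divergent sum has norm 0. *)
Lemma lp_norm_ge (S : choiceType) (f : S -> R) (a : R) : 0 <= a ->
  (lp_sum p f < +oo)%E -> ((a `^ p)%R%:E <= lp_sum p f)%E -> a <= lp_norm p f.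
Proof.
move=> a0 fy fa; have f0 := lp_sum_ge0 p f.
rewrite -[leLHS](powRK a0) ge0_ler_powR ?invr_ge0 ?(ltW p0) ?nnegrE ?fine_ge0//.
  exact: powR_ge0.
by rewrite -lee_fin fineK// ge0_fin_numE.
Qed.

Lemma lp_sum_le (S : choiceType) (f : S -> R) (a : R) :
  (lp_sum p f < +oo)%E -> lp_norm p f <= a -> (lp_sum p f <= (a `^ p)%R%:E)%E.
Proof.
move=> fy fa; have f0 := lp_sum_ge0 p f.
have f_fin : lp_sum p f \is a fin_num by rewrite ge0_fin_numE.
rewrite -[leLHS]fineK// lee_fin -[leLHS]powRVK ?fine_ge0//.
by apply: (ge0_ler_powR (ltW p0)); rewrite ?nnegrE ?powR_ge0// (le_trans (powR_ge0 _ _) fa).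
Qed.

Lemma lp_sum_ge (S : choiceType) (f : S -> R) (a : R) : 0 <= a ->
  a <= lp_norm p f -> ((a `^ p)%R%:E <= lp_sum p f)%E.
Proof.
move=> a0 fa; have f0 := lp_sum_ge0 p f.
have [->|f_fin] := eqVneq (lp_sum p f) +oo%E; first by rewrite leey.
rewrite -[leRHS]fineK ?ge0_fin_numE ?ltey// lee_fin -[leRHS]powRVK ?fine_ge0//.
by apply: (ge0_ler_powR (ltW p0)); rewrite ?nnegrE ?powR_ge0.
Qed.

Lemma lp_sum_comp_inj (S T : choiceType) (e : T -> S) (F : S -> R) : injective e ->
  lp_sum p (F \o e) = \esum_(s in range e) (`|F s| `^ p)%R%:E.
Proof.
move=> e_inj; rewrite (@esum_image _ _ _ setT e (fun s => (`|F s| `^ p)%R%:E))//.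
by move=> x y _ _ /e_inj.
Qed.

Lemma le_lp_sum_comp_inj (S T : choiceType) (e : T -> S) (F : S -> R) : injective e ->
  (lp_sum p (F \o e) <= lp_sum p F)%E.
Proof.
have F0 s : (0 <= (`|F s| `^ p)%R%:E)%E by rewrite lee_fin powR_ge0.
move=> /lp_sum_comp_inj ->; rewrite /lp_sum [leRHS](esumID (range e))// setTI.
by rewrite leeDl// esum_ge0.
Qed.

Lemma lp_sum_sum (S T : choiceType) (F : S + T -> R) :
  lp_sum p F = (lp_sum p (F \o inl) + lp_sum p (F \o inr))%E.
Proof.
rewrite (lp_sum_comp_inj F (@inl_inj _ _)) (lp_sum_comp_inj F (@inr_inj _ _)).
have F0 s : (0 <= (`|F s| `^ p)%R%:E)%E by rewrite lee_fin powR_ge0.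
rewrite /lp_sum (esumID (range inl))// !setTI; congr (_ + \esum_(s in _) _)%E.
apply/seteqP; split => [[s|t] /= Hs|_ [t _ <-] [s _]//].
  by exfalso; apply: Hs; exists s.
by exists t.
Qed.

Lemma Tagged_inj (J : choiceType) (X : J -> choiceType) (j : J) :
  injective (fun s : X j => Tagged X s).
Proof.
by move=> s t /eqP; rewrite -tag_eqE /tag_eq /= eqxx tagged_asE => /eqP.
Qed.

(** The remainder stays on the full index type, with the fibre over [j] set to zero, so that
    [block_coord_peel] can identify it with a difference of maps agreeing on that fibre. *)
Lemma lp_sum_tag (J : choiceType) (X : J -> choiceType) (F : {j : J & X j} -> R) (j : J) :
  lp_sum p F = (lp_sum p (fun s => F (Tagged X (s : X j)))
               + lp_sum p (fun u => if tag u == j then 0 else F u)%R)%E.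
Proof.
have F0 s : (0 <= (`|F s| `^ p)%R%:E)%E by rewrite lee_fin powR_ge0.
rewrite (lp_sum_comp_inj F (@Tagged_inj _ X j)).
rewrite /lp_sum (esumID (range (fun s : X j => Tagged X s)))// setTI; congr (_ + _)%E.
have tagE u : (tag u == j) = (u \in range (fun s : X j => Tagged X s)).
  apply/eqP/idP; last by rewrite inE => -[s _ <-].
  by case: u => i s /= ij; subst i; rewrite inE; exists s.
rewrite setTI [LHS]esum_mkcond; apply: eq_esum => u _.
rewrite tagE in_setC; case: (_ \in _) => //=.
by rewrite -[RHS]/((`|0 : R| `^ p)%:E) normr0 powR0 ?gt_eqF.
Qed.

Lemma lp_sum_fiber (J : choiceType) (X : J -> choiceType) (F : {j : J & X j} -> R) (j : J) :
  (forall u, tag u != j -> F u = 0) ->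
  lp_sum p F = lp_sum p (fun s => F (Tagged X (s : X j))).
Proof.
move=> F0; rewrite (lp_sum_tag F j) [X in (_ + X)%E]lp_sum0 ?adde0// => u.
by case: ifPn => // /F0.
Qed.

End lp_norms.

(** * Walks and simple paths *)

Section walks.
Variables (V : Type) (r : V -> V -> Prop).

Lemma walk_cat x y z m n : walk r x y m -> walk r y z n -> walk r x z (m + n).
Proof.
move=> xy yz; elim: xy yz => [//|{}x u {}y k xu _ IH] yz.
by rewrite addSn; apply: walk_cons xu (IH yz).
Qed.

Lemma walk1 x y : r x y -> walk r x y 1.
Proof. by move=> xy; apply: walk_cons xy (walk_nil _ _). Qed.

Lemma walk_sym x y n : (forall u v, r u v -> r v u) -> walk r x y n -> walk r y x n.
Proof.
move=> r_sym; elim=> [u|u v w k uv _ IH]; first exact: walk_nil.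
by rewrite -addn1; apply: walk_cat IH (walk1 (r_sym _ _ uv)).
Qed.

Lemma walk_last x y n : walk r x y n.+1 -> exists2 u, walk r x u n & r u y.
Proof.
move=> w; have : n.+1 = n.+1 by []; move: w.
move: {1 3}n.+1 => m w; elim: w n => [//|{}x u z k xu uz IH] n [kn].
subst k; case: n IH uz => [|n] IH uz.
  by exists x; [exact: walk_nil | inversion uz; subst].
by have [v uv vz] := IH n erefl; exists v => //; apply: walk_cons uv.
Qed.

(** Repetitions are cut out as vertices are prepended, so that the path can become part of a simple
    loop. *)
Lemma walk_uniq_path (T : eqType) (s : T -> T -> Prop) x y n : walk s x y n ->
  exists q : seq T, [/\ path (fun u v => `[< s u v >]) x q, last x q = y & uniq (x :: q)].
Proof.
elim=> {x y n} [u|u v w n /asboolP uv _ [q [vq qw _]]]; first by exists [::].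
have uvq : path (fun u v => `[< s u v >]) u (v :: q) by rewrite /= uv.
move: qw; rewrite -[last v q]/(last u (v :: q)).
by case/shortenP: uvq => q' uq' uniq_q' _ lastq'; exists q'.
Qed.

End walks.

(** * The shortest path metric *)

Section shortest_path_metric.
Variables (V : Type) (adj : V -> V -> Prop).
Hypotheses (adj_simp : simplicial adj) (adj_conn : graph_connected adj).
Let d := gdist adj.

Lemma gdist_spec x y : walk adj x y (d x y) /\ forall m, walk adj x y m -> (d x y <= m)%N.
Proof.
rewrite /d /gdist; case: xgetP => [n _ //|none].
(* If no length were minimal, every walk would yield a shorter one, which strong induction
   forbids. *)
exfalso; have [n] := adj_conn x y; elim/ltn_ind: n => n IH xyn.
apply: (none n); split => // m xym; rewrite leqNgt; apply/negP => mn.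
exact: IH m mn xym.
Qed.

Lemma gdist_walk x y : walk adj x y (d x y).
Proof. by have [] := gdist_spec x y. Qed.

Lemma gdist_le_walk x y m : walk adj x y m -> (d x y <= m)%N.
Proof. by have [_] := gdist_spec x y; apply. Qed.

Lemma gdist_triangle x y z : (d x z <= d x y + d y z)%N.
Proof. by apply: gdist_le_walk; apply: walk_cat (gdist_walk _ _) (gdist_walk _ _). Qed.

Lemma gdist_sym x y : d x y = d y x.
Proof.
by apply/eqP; rewrite eqn_leq !gdist_le_walk//; apply: walk_sym (gdist_walk _ _);
  case: adj_simp.
Qed.

Lemma gdistxx x : d x x = 0%N.
Proof. by apply/eqP; rewrite -leqn0 gdist_le_walk//; exact: walk_nil. Qed.

Lemma gdist_eq0 x y : d x y = 0%N -> x = y.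
Proof. by move=> d0; have := gdist_walk x y; rewrite d0 => w; inversion w. Qed.

Lemma gdist_adj x y : adj x y -> (d x y <= 1)%N.
Proof. by move=> xy; apply: gdist_le_walk; exact: walk1. Qed.

Lemma gdist_adj_le e x y : adj x y -> (d e y <= (d e x).+1)%N.
Proof.
move=> xy1; have xy := gdist_adj xy1.
by rewrite -addn1 (leq_trans (gdist_triangle e x y))// leq_add2l.
Qed.

Lemma gdist_pred e x : x <> e -> exists2 y, adj x y & d e x = (d e y).+1.
Proof.
move=> xe; case dn : (d e x) => [|n]; first by case: xe; rewrite (gdist_eq0 dn).
have := gdist_walk e x; rewrite dn => w; have [y ey yx] := walk_last w.
exists y; first exact: adj_simp.1.
apply/eqP; rewrite eqSS eqn_leq (gdist_le_walk ey) andbT -ltnS -dn.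
exact: gdist_adj_le.
Qed.

End shortest_path_metric.

(** * Blocks: the pieces and the edges outside them *)

Section blocks.
Variables (V : choiceType) (I : Type) (adj : V -> V -> Prop).
Variables (Vp : I -> set V) (Ep : I -> V -> V -> Prop).
Hypotheses (adj_simp : simplicial adj) (tg : tree_graded adj Vp Ep).

(** The condition concerns the ends only, not the edge sets [Ep]; hence a piece and a bridge never
    share two vertices. *)
Definition is_bridge (s : set V) : Prop :=
  exists u v, [/\ s = [set u; v], adj u v & ~ exists i, Vp i u /\ Vp i v].

(* An edge in no piece is labelled by its vertex set, which makes its two orientations the
   same block; other sets label the empty block. *)
Definition block (j : I + set V) : set V :=
  match j with
  | inl i => Vp i
  | inr s => [set x | s x /\ is_bridge s]
  end.

Lemma bridge_ends s x y : block (inr s) x -> block (inr s) y -> x <> y ->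
  [/\ s = [set x; y], adj x y & ~ exists i, Vp i x /\ Vp i y].
Proof.
move=> [sx [u [v [sE uv npiece]]]] [sy _] xy; move: sx sy; rewrite sE.
case=> xE [] yE; rewrite xE yE in xy *; [by []|by split| |by []].
split; [by rewrite setUC|exact: adj_simp.1|].
by move=> [i [iv iu]]; apply: npiece; exists i.
Qed.

Lemma block_edge x y : adj x y -> exists j, block j x /\ block j y.
Proof.
move=> xy; have [[i xyi]|npiece] := pselect (exists i, Vp i x /\ Vp i y).
  by exists (inl i).
by exists (inr [set x; y]); split; (split; [by [left]||by right|exists x, y]).
Qed.

Lemma piece_inter i j x y : Vp i x -> Vp j x -> Vp i y -> Vp j y -> x <> y -> i = j.
Proof.
move=> ix jx iy jy xy; apply: contrapT => ij; apply: xy.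
by have [_ [_ [_ /(_ i j ij)[_ one]]]] := tg; apply: one.
Qed.

Lemma block_inter i j x y :
  block i x -> block j x -> block i y -> block j y -> x <> y -> i = j.
Proof.
case: i j => [i|s] [j|t] ix jx iy jy xy.
- by rewrite (piece_inter ix jx iy jy xy).
- by have [_ _] := bridge_ends jx jy xy; case; exists i.
- by have [_ _] := bridge_ends ix iy xy; case; exists j.
- by have [-> _ _] := bridge_ends ix iy xy; have [-> _ _] := bridge_ends jx jy xy.
Qed.

Let adjb u v := `[< adj u v >].

Lemma loop_in_piece (s : seq V) : (3 <= size s)%N -> uniq s -> cycle adjb s ->
  exists i, forall x, x \in s -> Vp i x.
Proof.
case: s => [//|a q] sz uniq_s cyc.
have [_ [_ [loop _]]] := tg.
have [|i [Vi _]] := loop (size (a :: q)) (nth a (a :: q)).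
  split=> //; split=> [k l kq lq /eqP|k kq].
    by rewrite nth_uniq// => /eqP.
  have /(pathP a) := cyc => /(_ k); rewrite size_rcons -/(size (a :: q)) => /(_ kq).
  rewrite -rcons_cons nth_rcons kq => /asboolP.
  (* At the last index the successor modulo the length is 0, which is the closing edge back to
     [a]. *)
  rewrite nth_rcons; have [kq'|kq'] := ltnP k (size q).
    by rewrite modn_small.
  have -> : k = size q by apply/eqP; rewrite eqn_leq kq' andbT -ltnS.
  by rewrite eqxx modnn.
by exists i => x xs; rewrite -(nth_index a xs); apply: Vi; rewrite index_mem.
Qed.

(** In a piece the path comes from connectedness, in a bridge it is the edge itself. The end [a] is
    split off so that the loop of [block_gap] lists it once. *)
Lemma block_path j a b : block j a -> block j b -> a <> b ->
  exists q, [/\ path adjb b (rcons q a), uniq (b :: rcons q a) &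
                forall x, x \in b :: rcons q a -> block j x].
Proof.
case: j => [i|s] ja jb ab; last first.
  have [_ ab_adj _] := bridge_ends ja jb ab; exists [::]; split=> /=.
  - by rewrite andbT; apply/asboolP; apply: adj_simp.1.
  - by rewrite inE andbT; apply/eqP => /esym.
  - by move=> x; rewrite !inE => /orP[]/eqP ->.
have [/(_ i)[[Ei _] [_ conn]] _] := tg.
have [n /walk_uniq_path[q [bq qa uniq_q]]] := conn b a jb ja.
have qi x : x \in b :: q -> Vp i x.
  rewrite inE => /predU1P[->//|].
  elim: q b bq {qa uniq_q jb ab conn} => [//|y q IH] b /= /andP[/asboolP /Ei[_ [_ iy]] yq].
  by rewrite inE => /predU1P[->//|]; exact: IH yq.
case/lastP: q => [|q z] in bq qa uniq_q qi *; first by case: ab.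
move: qa; rewrite last_rcons => za; subst z.
exists q; split=> //; apply: sub_path bq => u v /asboolP /Ei[uv _]; exact/asboolP.
Qed.

(* Otherwise an excursion outside a block, closed up inside the block, would be a simple loop. *)
Lemma block_gap j a b c c' n : block j a -> block j b -> ~ block j c ->
  adj a c -> adj c' b ->
  walk (fun u v => [/\ adj u v, ~ block j u & ~ block j v]) c c' n -> a = b.
Proof.
move=> ja jb jc ac cb /walk_uniq_path[p [cp pc' uniq_p]].
apply: contrapT => ab.
have [q [bq uniq_q jq]] := block_path ja jb ab.
have jp x : x \in c :: p -> ~ block j x.
  rewrite inE => /predU1P[->//|].
  elim: p c cp {pc' uniq_p jc ac} => [//|y p IH] c /= /andP[/asboolP[_ _ jy] yp].
  by rewrite inE => /predU1P[->//|]; exact: IH yp.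
have disj x : x \in c :: p -> x \in b :: rcons q a -> False.
  by move=> /jp jx /jq.
(* The loop goes from [a] to [c], along [p] to [c'], on to [b], and back to [a] inside the block
   along [q]. *)
have [||| i si] := @loop_in_piece (a :: ((c :: p) ++ b :: q)).
- by rewrite /= size_cat /= addnS.
- rewrite cons_uniq -rcons_uniq rcons_cat rcons_cons cat_uniq uniq_p uniq_q andbT.
  by apply/hasPn => x xq; apply/negP => xp; exact: disj xp xq.
- rewrite /cycle rcons_cat rcons_cons cat_path /= pc' bq.
  rewrite (_ : adjb a c)//=; last exact/asboolP.
  rewrite (_ : adjb c' b)//=; last exact/asboolP.
  by rewrite andbT; apply: sub_path cp => u v /asboolP[uv _ _]; exact/asboolP.
have [ia ib ic] : [/\ Vp i a, Vp i b & Vp i c].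
  by split; apply: si; rewrite !(inE, mem_cat) eqxx ?orbT.
(* A piece [j] shares [a] and [b] with piece [i], hence equals it and contains [c]; a bridge cannot
   have both ends in piece [i]. *)
case: j ja jb jc {jq jp disj cp cb ac} => [j|s] ja jb jc.
  by apply: jc; rewrite /= -(piece_inter ia ja ib jb ab).
by have [_ _] := bridge_ends ja jb ab; case; exists i.
Qed.

End blocks.

(** * Gates and geodesics towards the root *)

Section rooted_blocks.
Variables (V J : choiceType) (adj : V -> V -> Prop) (W : J -> set V) (e : V).
Variable j0 : J.
Hypotheses (adj_simp : simplicial adj) (adj_conn : graph_connected adj).
Hypothesis W_edge : forall x y, adj x y -> exists j, W j x /\ W j y.
Hypothesis W_inter : forall i j x y,
  W i x -> W j x -> W i y -> W j y -> x <> y -> i = j.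
Hypothesis W_gap : forall j a b c c' n, W j a -> W j b -> ~ W j c ->
  adj a c -> adj c' b ->
  walk (fun u v => [/\ adj u v, ~ W j u & ~ W j v]) c c' n -> a = b.

Let h := gdist adj e.

Definition gate (j : J) : V :=
  xget e [set x | W j x /\ forall y, W j y -> (h x <= h y)%N].

(** The default [j0] is taken at the root only, which has no neighbour of smaller height. *)
Definition below (x : V) : J :=
  xget j0 [set j | W j x /\ exists y, [/\ adj x y, h x = (h y).+1 & W j y]].

Lemma gateP j x : W j x -> W j (gate j) /\ forall y, W j y -> (h (gate j) <= h y)%N.
Proof.
move=> jx; rewrite /gate; case: xgetP => [n _ //|none]; exfalso.
have [n xn] : exists n, h x = n by exists (h x).
elim/ltn_ind: n x xn jx => n IH x xn jx.
apply: (none x); split => // y jy; rewrite leqNgt; apply/negP; rewrite xn => hn.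
exact: (IH _ hn y).
Qed.

Lemma belowP x : x <> e ->
  W (below x) x /\ exists y, [/\ adj x y, h x = (h y).+1 & W (below x) y].
Proof.
move=> xe; rewrite /below; case: xgetP => [n _ //|none]; exfalso.
have [y xy hy] := gdist_pred adj_simp adj_conn xe; have [j [jx jy]] := W_edge xy.
by apply: (none j); split => //; exists y.
Qed.

Let out j u v := [/\ adj u v, ~ W j u & ~ W j v].

(** Follow a geodesic from [c] to the root until it first meets block [j], if it ever does. *)
Lemma descend_outside j c : ~ W j c ->
  (exists2 m, walk (out j) c e m & ~ W j e) \/
  (exists c' b m, [/\ walk (out j) c c' m, adj c' b, W j b & (h b < h c)%N]).
Proof.
have [n cn] : exists n, h c = n by exists (h c).
elim/ltn_ind: n c cn => n IH c cn jc.
have [ce|ce] := pselect (c = e).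
  by left; exists 0%N; [rewrite ce; exact: walk_nil|rewrite -ce].
have [y cy hy] := gdist_pred adj_simp adj_conn ce.
have [jy|jy] := pselect (W j y).
  right; exists c, y, 0%N; split => //; first exact: walk_nil.
  by rewrite -/h in hy; rewrite hy.
have yn : (h y < n)%N by rewrite -cn; rewrite -/h in hy; rewrite hy.
have [[m w je]|[c' [b [m [w cb jb hb]]]]] := IH _ yn y erefl jy.
  by left; exists m.+1 => //; apply: walk_cons w.
right; exists c', b, m.+1; split => //; first by apply: walk_cons w.
by rewrite (ltn_trans hb)// cn.
Qed.

(** Suppose the geodesic leaves the block at [y]. By [W_gap] it could return only to [y], which is
    too far from [e], so it reaches [e] outside the block. So does a geodesic from the gate, as
    nothing in the block is nearer to [e]. The two together form an excursion from [y] to the gate,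
    whence [y] is the gate. *)
Lemma pred_in_block j y y' : W j y -> y <> gate j ->
  adj y y' -> h y = (h y').+1 -> W j y'.
Proof.
move=> jy yg yy' hy; apply: contrapT => jy'.
have [jg g_min] := gateP jy.
have [[m w je]|[c' [b [m [w cb jb hb]]]]] := descend_outside jy'; last first.
  have yb := W_gap jy jb jy' yy' cb w.
  by move: hb; rewrite -yb hy ltnNge leqnSn.
have ge : gate j <> e by move=> ge; rewrite ge in jg.
have [g' gg' hg] := gdist_pred adj_simp adj_conn ge; rewrite -/h in hg.
have jg' : ~ W j g' by move=> /g_min; rewrite hg ltnn.
have [[m' w' _]|[c' [b [m' [w' cb jb hb]]]]] := descend_outside jg'; last first.
  have := leq_ltn_trans (g_min _ jb) hb; by rewrite hg ltnNge leqnSn.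
apply: yg; apply: (W_gap jy jg jy' yy' (adj_simp.1 _ _ gg')).
apply: walk_cat w (walk_sym _ w') => u v [uv ju jv].
by split => //; exact: adj_simp.1.
Qed.

(** Both [W j] and [W (below y)] contain [y] and a neighbour of [y] nearer to the root, so [W_inter]
    identifies them. *)
Lemma below_eq j y : W j y -> y <> gate j -> y <> e /\ below y = j.
Proof.
move=> jy yg; have ye : y <> e.
  move=> ye; apply: yg; have [jg /(_ _ jy)] := gateP jy.
  have -> : h y = 0%N by rewrite ye; exact: gdistxx.
  rewrite leqn0 => /eqP g0.
  by rewrite ye; exact: gdist_eq0 g0.
split => //; have [by_ [y' [yy' hy by']]] := belowP ye.
have jy' := pred_in_block jy yg yy' hy.
apply: (W_inter by_ jy by' jy') => yy; move: hy; rewrite -/h -yy => /eqP.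
by rewrite -[X in X == _]addn0 -addn1 eqn_add2l.
Qed.

Lemma gate_lt x : x <> e -> (h (gate (below x)) < h x)%N.
Proof.
move=> xe; have [bx [y [xy hy by_]]] := belowP xe.
by rewrite hy ltnS; have [_] := gateP bx; apply.
Qed.

(** By [pred_in_block], a geodesic from [y] to the root stays in the block until it reaches the
    gate. *)
Lemma gate_dist j y : W j y -> h y = (h (gate j) + gdist adj (gate j) y)%N.
Proof.
move=> jy; apply/eqP; rewrite eqn_leq gdist_triangle//=.
have [n yn] : exists n, h y = n by exists (h y).
elim/ltn_ind: n y yn jy => n IH y yn jy.
have [->|yg] := pselect (y = gate j); first by rewrite gdistxx// addn0.
have [ye _] := below_eq jy yg.
have [y' yy' hy] := gdist_pred adj_simp adj_conn ye; rewrite -/h in hy.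
have jy' := pred_in_block jy yg yy' hy.
have y'n : (h y' < n)%N by rewrite -yn hy.
rewrite hy -addn1; apply: leq_trans (leq_add (IH _ y'n _ erefl jy') (leqnn 1)).
rewrite -addnA leq_add2l (leq_trans (gdist_triangle adj_conn _ y' _))// leq_add2l.
by apply: gdist_adj => //; exact: adj_simp.1.
Qed.

Lemma block_edge_below x y : adj x y ->
  exists j, [/\ W j x, W j y, x = gate j \/ x <> e /\ below x = j
                & y = gate j \/ y <> e /\ below y = j].
Proof.
move=> /W_edge[j [jx jy]]; exists j; split => //.
- by have [|xg] := pselect (x = gate j); [left|right; exact: below_eq].
- by have [|xg] := pselect (y = gate j); [left|right; exact: below_eq].
Qed.

End rooted_blocks.

(** * The tree of ancestors and the projections to blocks *)

Section embedding.
Variables (V J : choiceType) (e : V) (h : V -> nat) (b : V -> J) (g : J -> V).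
Hypothesis g_lt : forall x, x <> e -> (h (g (b x)) < h x)%N.

Definition parent (x : V) : V := if x == e then e else g (b x).

(** A vertex counts among its own ancestors, the root never does. Each ancestor [u] represents the
    block [b u] traversed between [u] and its gate. *)
Definition anc (u x : V) : Prop := u <> e /\ exists k, u = iter k parent x.

Lemma parentE x : x <> e -> parent x = g (b x).
Proof. by move=> /eqP/negPf xe; rewrite /parent xe. Qed.

Lemma parent_ind (P : V -> Prop) :
  P e -> (forall x, x <> e -> P (g (b x)) -> P x) -> forall x, P x.
Proof.
move=> Pe Pq x; have [n xn] : exists n, h x = n by exists (h x).
elim/ltn_ind: n x xn => n IH x xn.
have [->//|xe] := pselect (x = e).
by apply: Pq => //; apply: IH erefl; rewrite -xn g_lt.
Qed.

Lemma anc_root u : ~ anc u e.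
Proof.
move=> [ue [k uk]]; apply: ue; rewrite uk; elim: k {uk} => //= k ->.
by rewrite /parent eqxx.
Qed.

Lemma anc_neq u x : anc u x -> u <> e. Proof. by case. Qed.

Lemma anc_self x : x <> e -> anc x x. Proof. by move=> xe; split => //; exists 0%N. Qed.

Lemma ancE u x : x <> e -> anc u x <-> u = x \/ anc u (g (b x)).
Proof.
move=> xe; split=> [[ue [[|k] uk]]|[->|[ue [k uk]]]].
- by left.
- by right; split => //; exists k; rewrite -parentE// -iterSr.
- exact: anc_self.
- by split => //; exists k.+1; rewrite iterSr parentE.
Qed.

Lemma anc_leq u x : anc u x -> (h u <= h x)%N.
Proof.
elim/parent_ind: x => [/anc_root//|x xe IH] /(ancE _ xe)[->//|/IH ux].
by rewrite (leq_trans ux)// ltnW// g_lt.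
Qed.

Lemma anc_total u v x : anc u x -> anc v x ->
  [\/ u = v, anc u (g (b v)) | anc v (g (b u))].
Proof.
elim/parent_ind: x => [/anc_root//|x xe IH] /(ancE _ xe) ux /(ancE _ xe).
case: ux => [->|ux] [->|vx]; first by constructor 1.
- by constructor 3.
- by constructor 2.
- exact: IH.
Qed.

(** Otherwise one of them is an ancestor of the gate of their common block, although its height
    exceeds that of this gate. *)
Lemma anc_inj u v x : anc u x -> anc v x -> b u = b v -> u = v.
Proof.
move=> ux vx uv; case: (anc_total ux vx) => [//|/anc_leq|/anc_leq].
- by rewrite -uv leqNgt g_lt//; exact: anc_neq ux.
- by rewrite uv leqNgt g_lt//; exact: anc_neq vx.
Qed.

(** This plays the role of the nearest point to [x] in block [j]: the ancestor of [x] hanging below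
    [j], unique by [anc_inj], and the gate if there is none. *)
Definition block_proj (j : J) (x : V) : V := xget (g j) [set u | anc u x /\ b u = j].

Lemma block_projP j x : block_proj j x = g j \/ anc (block_proj j x) x /\ b (block_proj j x) = j.
Proof. by rewrite /block_proj; case: xgetP => [u _ /=|]; [right|left]. Qed.

Lemma block_proj_anc u x : anc u x -> block_proj (b u) x = u.
Proof.
move=> ux; rewrite /block_proj; case: xgetP => [v _ /= [vx /(anc_inj vx ux)//]|none].
by case: (none u).
Qed.

Lemma block_proj_gate j : block_proj j (g j) = g j.
Proof.
case: (block_projP j (g j)) => // -[/[dup] ug /anc_leq + uj]; rewrite -[X in h (g X)]uj.
by rewrite leqNgt g_lt//; exact: anc_neq ug.
Qed.

Lemma block_proj_root j : block_proj j e = g j.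
Proof. by case: (block_projP j e) => // -[/anc_root]. Qed.

Lemma block_proj_self x : x <> e -> block_proj (b x) x = x.
Proof. by move=> xe; apply/block_proj_anc/anc_self. Qed.

Lemma block_proj_other j x : x <> e -> j <> b x -> block_proj j x = block_proj j (g (b x)).
Proof.
move=> xe jx; rewrite /block_proj; congr (xget _ _); apply/seteqP; split => u /= [].
  by move=> /(ancE _ xe)[->/esym//|ux uj].
by move=> ux uj; split => //; apply/(ancE _ xe); right.
Qed.

Lemma block_proj_neq_gate u x : anc u x -> block_proj (b u) x <> g (b u).
Proof.
move=> ux; rewrite block_proj_anc// => ug; have := g_lt (anc_neq ux).
by rewrite -ug ltnn.
Qed.

(* If each of the blocks of x and y were met by the ancestors of the other vertex, those
   ancestors would lie strictly above each other; so x or y can be replaced by its gate. *)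
Lemma peel_cases x y : [\/ x = y, [/\ x <> e, y <> e & b x = b y],
  x <> e /\ block_proj (b x) y = g (b x) | y <> e /\ block_proj (b y) x = g (b y)].
Proof.
have [->|xe] := pselect (x = e).
  have [->|ye] := pselect (y = e); first by constructor 1.
  by constructor 4; rewrite block_proj_root.
have [->|ye] := pselect (y = e); first by constructor 3; rewrite block_proj_root.
case: (block_projP (b x) y) => [|[vy vb]]; first by constructor 3.
case: (block_projP (b y) x) => [|[wx wb]]; first by constructor 4.
set v := block_proj (b x) y in vy vb; set w := block_proj (b y) x in wx wb.
have [vy'|vy'] := (ancE v ye).1 vy; first by constructor 2; rewrite -vb vy'.
have [wx'|wx'] := (ancE w xe).1 wx; first by constructor 2; rewrite -wb wx'.
have vw : (h v < h w)%N by rewrite (leq_ltn_trans (anc_leq vy'))// -wb g_lt//; exact: anc_neq wx.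
have wv : (h w < h v)%N by rewrite (leq_ltn_trans (anc_leq wx'))// -vb g_lt//; exact: anc_neq vy.
by have := ltn_trans vw wv; rewrite ltnn.
Qed.

(** Induction along the chain of blocks joining [x] to [y], on the sum of heights: [peel_cases]
    tells which end can be replaced by its gate. *)
Lemma peel_ind (P : V -> V -> Prop) : (forall x, P x x) ->
  (forall x y, x <> e -> y <> e -> b x = b y -> P x y) ->
  (forall x y, x <> e -> block_proj (b x) y = g (b x) -> P (g (b x)) y -> P x y) ->
  (forall x y, P x y -> P y x) -> forall x y, P x y.
Proof.
move=> Pxx Pblock Pstep Psym x y.
have [n xyn] : exists n, (h x + h y)%N = n by exists (h x + h y)%N.
elim/ltn_ind: n x y xyn => n IH x y xyn.
case: (peel_cases x y) => [->//|[xe ye bxy]|[xe xy]|[ye yx]]; first exact: Pblock.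
- by apply: Pstep => //; apply: IH erefl; rewrite -xyn ltn_add2r g_lt.
- by apply/Psym/Pstep => //; apply/Psym/(IH _ _ _ _ erefl); rewrite -xyn ltn_add2l g_lt.
Qed.

Variable d : V -> V -> nat.
Hypothesis d_triangle : forall x y z, (d x z <= d x y + d y z)%N.
Hypothesis d_gate : forall x, x <> e -> h x = (h (g (b x)) + d (g (b x)) x)%N.
Hypothesis dxx : forall x, d x x = 0%N.

(** The blocks met between [x] and the height of [a] are not traversed by the ancestors of [y], so
    all coordinates of [y] attached to them vanish. *)
Definition apart (a x y : V) := forall u, anc u x -> (h a < h u)%N ->
  block_proj (b u) y = g (b u).

(** The chains of [x] and [y] towards the root meet either in one vertex or in one block, which they
    enter at [a] and [c]. *)
Lemma meet_exists x y : exists a c,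
  [/\ (h a + d a x <= h x)%N /\ (h c + d c y <= h y)%N,
      a = c \/ [/\ a <> e /\ c <> e, b a = b c, block_proj (b a) x = a & block_proj (b a) y = c],
      apart a x y & apart c y x].
Proof.
move: x y; apply: peel_ind => [x|x y xe ye bxy|x y xe xy|x y].
- exists x, x; rewrite dxx addn0; split => //; [by left| |] => u /anc_leq ux;
    by rewrite ltnNge ux.
- exists x, y; rewrite !dxx !addn0; split => //; first 1 last.
  + by move=> u /anc_leq ux; rewrite ltnNge ux.
  + by move=> u /anc_leq ux; rewrite ltnNge ux.
  by right; split => //; [exact: block_proj_self|rewrite bxy; exact: block_proj_self].
- move=> [a [c [[ax cy] ac xy_apart yx_apart]]]; exists a, c; split.
  + split => //; rewrite (d_gate xe); move: ax (d_triangle a (g (b x)) x); lia.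
  + case: ac => [|[[ae ce] bac pa pc]]; [by left|right; split => //].
    (* Were [b a = b x], the projection [c] of [y] would be the gate of its own block, against
       [g_lt]. *)
    have [bax|bax] := pselect (b a = b x); last by rewrite block_proj_other.
    by have := g_lt ce; rewrite -bac bax -xy -bax pc ltnn.
  + by move=> u /(ancE _ xe)[->//|]; exact: xy_apart.
  + move=> u uy cu; have [bux|bux] := pselect (b u = b x).
      by have := block_proj_neq_gate uy; rewrite bux xy.
    by rewrite block_proj_other//; exact: yx_apart.
- move=> [a [c [[ax cy] ac xy_apart yx_apart]]]; exists c, a; split => //.
  by case: ac => [|[[ae ce] bac pa pc]]; [left|right; rewrite -bac; split].
Qed.
(** For fixed [u] the numbers [H - h u + k] run from [H - h u] up to, but excluding,
    [H - h (g (b u))]; along a chain of ancestors these intervals are disjoint. *)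
Lemma depth_inj H x u v k l : anc u x -> anc v x -> (h x <= H)%N ->
  (k < h u - h (g (b u)))%N -> (l < h v - h (g (b v)))%N ->
  (H - h u + k = H - h v + l)%N -> u = v /\ k = l.
Proof.
move=> ux vx xH ku lv kl; have uH := anc_leq ux; have vH := anc_leq vx.
case: (anc_total ux vx) => [uv|/anc_leq uv|/anc_leq vu]; last 2 first.
- by exfalso; move: xH ku lv kl uH vH uv; lia.
- by exfalso; move: xH ku lv kl uH vH vu; lia.
by split=> //; subst v; move/addnI : kl.
Qed.

(** For [H = h x] the intervals of [depth_inj] are adjacent and end at the root, so they tile the
    numbers below [h x]. *)
Lemma depth_surj x n : h e = 0%N -> (n < h x)%N ->
  exists u k, [/\ anc u x, (k < h u - h (g (b u)))%N & n = (h x - h u + k)%N].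
Proof.
move=> he; elim/parent_ind: x n => [n|x xe IH n nx]; first by rewrite he.
have gx := g_lt xe; have [nl|nl] := ltnP n (h x - h (g (b x))).
  by exists x, n; split=> //; [exact: anc_self|rewrite subnn].
have [|u [k [ux ku nE]]] := IH (n - (h x - h (g (b x))))%N.
  by move: nl nx gx; lia.
exists u, k; split => //; first by apply/(ancE _ xe); right.
by move: (anc_leq ux) nE nl nx gx; lia.
Qed.

(** * Coordinates of the embedding *)

Variables (R : realType) (p : R) (p1 : 1 <= p).
Variables (X : J -> choiceType) (psi : forall j, V -> X j -> R) (F : nat -> R).
Hypothesis F_ge0 : forall n, 0 <= F n.

(** Subtracting the value at the gate leaves only the finitely many blocks below which an ancestor
    of [x] hangs, and sends the root to 0. *)
Definition block_coord (x : V) (s : {j : J & X j}) : R :=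
  psi (block_proj (tag s) x) (tagged s) - psi (g (tag s)) (tagged s).

(** The step from [t] to [t + 1] is nonzero only for [k <= t], the range where [F_double] compares
    [F (t + 1)] with [F (t + k + 1)]. *)
Definition ramp (t k : nat) : R := \sum_(k <= i < t) F i.+1.

Definition ancestor_coord (x : V) (s : V * nat) : R :=
  if `[< anc s.1 x /\ (s.2 < h s.1 - h (g (b s.1)))%N >] then ramp (h x - h s.1) s.2
  else 0.

Definition embedding (x : V) (s : {j : J & X j} + V * nat) : R :=
  match s with inl s1 => block_coord x s1 | inr s2 => ancestor_coord x s2 end.

Lemma lp_sum_embedding x y : lp_sum p (embedding x \- embedding y) =
  (lp_sum p (block_coord x \- block_coord y)%R
   + lp_sum p (ancestor_coord x \- ancestor_coord y)%R)%E.
Proof. by rewrite lp_sum_sum. Qed.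

Lemma embedding_root s : embedding e s = 0.
Proof.
case: s => [s|s]; first by rewrite /= /block_coord block_proj_root subrr.
by rewrite /= /ancestor_coord asboolF// => -[/anc_root].
Qed.

Lemma block_coord_ge x y j :
  (lp_sum p (psi (j := j) (block_proj j x) \- psi (block_proj j y))%R
   <= lp_sum p (block_coord x \- block_coord y)%R)%E.
Proof.
apply: le_trans (le_lp_sum_comp_inj p _ (@Tagged_inj _ X j)).
rewrite le_eqVlt; apply/orP; left; apply/eqP; apply: eq_lp_sum => s /=.
by rewrite /block_coord /=; ring.
Qed.

Lemma block_coord_eq x y j : (forall i, i <> j -> block_proj i x = block_proj i y) ->
  lp_sum p (block_coord x \- block_coord y) =
  lp_sum p (psi (j := j) (block_proj j x) \- psi (block_proj j y)).
Proof.
move=> xy; rewrite (lp_sum_fiber p1 (j := j)).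
  by apply: eq_lp_sum => s /=; rewrite /block_coord /=; ring.
by move=> s /eqP sj /=; rewrite /block_coord xy// subrr.
Qed.

(** In the block [b x] both [y] and the gate of [x] project to the gate; in every other block [x]
    and its gate have the same projection. *)
Lemma block_coord_peel x y : x <> e -> block_proj (b x) y = g (b x) ->
  lp_sum p (block_coord x \- block_coord y) =
  (lp_sum p (psi (j := b x) x \- psi (g (b x)))%R
   + lp_sum p (block_coord (g (b x)) \- block_coord y)%R)%E.
Proof.
move=> xe xy; rewrite (lp_sum_tag p1 _ (b x)); congr (_ + _)%E; apply: eq_lp_sum.
  by move=> s /=; rewrite /block_coord /= xy (block_proj_self xe); ring.
move=> [i s] /=; rewrite /block_coord /=; case: eqP => [ix|ix].
  by subst i; rewrite block_proj_gate xy subrr.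
by rewrite (block_proj_other xe ix).
Qed.

(** Among the coordinates of [x] on which [y] vanishes, a quarter of [h x - h a] many are selected,
    each at least [v]. *)
Lemma ancestor_coord_ge x y a (v : R) : h e = 0%N -> apart a x y -> 0 <= v ->
  (forall u, anc u x -> (h a < h u)%N ->
     (4 * (h u - h (g (b u))) < h x - h a)%N) ->
  (forall t k, (t <= h x - h a)%N -> (h x - h a < 2 * t)%N -> (4 * k < h x - h a)%N ->
     v <= ramp t k) ->
  ((((h x - h a) %/ 4)%:R * v `^ p)%R%:E
   <= lp_sum p (ancestor_coord x \- ancestor_coord y)%R)%E.
Proof.
move=> he xy v0 short ramp_ge; set D := (h x - h a)%N in short ramp_ge *.
set m := (D %/ 4)%N.
have m4 : (4 * m <= D)%N by rewrite /m; lia.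
(* The depths [D - m + i] form the last quarter before [a]. Since [k < D / 4], the ramp length
   [h x - h u] there lies strictly between [D / 2] and [D]. *)
have /choice[s sP] : forall i, exists s : V * nat, (i < m)%N ->
    [/\ anc s.1 x, (s.2 < h s.1 - h (g (b s.1)))%N &
        (D - m + i)%N = (h x - h s.1 + s.2)%N].
  move=> i; have [im|mi] := ltnP i m; last by exists (x, 0%N).
  have [|u [k [ux ku nE]]] := @depth_surj x (D - m + i) he; last by exists (u, k).
  by move: im m4; rewrite /D; lia.
have sP' i : (i < m)%N -> v <= ancestor_coord x (s i) /\ ancestor_coord y (s i) = 0.
  move=> im; have [ux ku nE] := sP i im; have hux := anc_leq ux.
  have au : (h a < h (s i).1)%N by move: nE im m4 ku hux; rewrite /D; lia.
  have k4 : (4 * (s i).2 < D)%N by move: (short _ ux au) ku; lia.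
  split; rewrite /ancestor_coord.
    by rewrite asboolT//; apply: ramp_ge => //; move: nE im m4 k4; lia.
  by rewrite asboolF// => -[uy _]; apply: (block_proj_neq_gate uy); exact: xy.
have s_inj : set_inj `I_m s.
  move=> i j; rewrite !inE /= => im jm sij.
  have [_ _ iE] := sP i im; have [_ _ jE] := sP j jm.
  by move: iE; rewrite sij -jE => /addnI.
pose G w := ((`|(ancestor_coord x \- ancestor_coord y) w| `^ p)%R%:E).
have G0 w : (0 <= G w)%E by rewrite lee_fin powR_ge0.
apply: (@le_trans _ _ (\esum_(w in s @` `I_m) G w)); last first.
  by rewrite /lp_sum [leRHS](esumID (s @` `I_m))// setTI leeDl// esum_ge0.
rewrite esum_image// esum_fset//.
rewrite -fsbig_ord sumEFin lee_fin.
rewrite mulr_natl -[in leLHS](card_ord m) -sumr_const.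
apply: ler_sum => i _; have [vi yi] := sP' i (ltn_ord i).
apply: ge0_ler_powR; rewrite ?nnegrE ?(le_trans _ p1)//=.
by rewrite yi subr0 (le_trans vi)// ler_norm.
Qed.

(** * Lower bounds for the embedding *)

Variable W : J -> set V.
Hypothesis W_below : forall x, x <> e -> W (b x) x /\ W (b x) (g (b x)).

Variable rho : nat -> R.
Hypotheses (rho_concave : concave_fun rho) (rho0 : rho 0%N = 0).

(** The block sums add up exactly under [block_coord_peel], which matches subadditivity of [rho].
    For [p = 1] the sums are the norms themselves. *)
Lemma block_coord_subadd x y : (forall x y, d x y = d y x) ->
  (forall j x y, W j x -> W j y ->
    ((rho (d x y))%:E <= lp_sum p (psi (j := j) x \- psi y)%R)%E) ->
  ((rho (d x y))%:E <= lp_sum p (block_coord x \- block_coord y)%R)%E.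
Proof.
move=> d_sym psi_ge; move: x y; apply: peel_ind.
- by move=> x; rewrite dxx rho0 lp_sum_ge0.
- move=> x y xe ye bxy; rewrite (block_coord_eq (j := b x)).
    rewrite block_proj_self// bxy block_proj_self// psi_ge//.
      by rewrite -bxy; have [] := W_below xe.
    by have [] := W_below ye.
  by move=> i ix; rewrite (block_proj_other xe)// (block_proj_other ye) -?bxy.
- move=> x y xe xy IH; rewrite block_coord_peel//.
  have [Wx Wg] := W_below xe.
  apply: le_trans (leeD (psi_ge _ _ _ Wx Wg) IH).
  rewrite -EFinD lee_fin (le_trans _ (concave_fun_subadd _ _ rho_concave))//.
  by case: rho_concave => _ [+ _]; apply.
- by move=> x y; rewrite d_sym lp_sum_sym.
Qed.

Variables (f v : nat -> R).
Hypotheses (f_concave : concave_fun f) (v_ge0 : forall D, 0 <= v D).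
Hypothesis v_ramp : forall D t k, (t <= D)%N -> (D < 2 * t)%N -> (4 * k < D)%N ->
  v D <= ramp t k.
Hypothesis v_count : forall D, (4 <= D)%N ->
  (f D / 32) `^ p <= (D %/ 4)%:R * v D `^ p.
Hypothesis psi_ge : forall j x y, W j x -> W j y ->
  ((rho (d x y) `^ p)%R%:E <= lp_sum p (psi (j := j) x \- psi y)%R)%E.
Hypotheses (he : h e = 0%N) (d_sym : forall x y, d x y = d y x).

Let rho_ge0 n : 0 <= rho n. Proof. by case: rho_concave. Qed.
Let f_ge0 n : 0 <= f n. Proof. by case: f_concave. Qed.
Let powR_le (x y : R) : 0 <= x -> x <= y -> x `^ p <= y `^ p.
Proof.
move=> x0 xy; apply: ge0_ler_powR; rewrite ?nnegrE ?(le_trans _ xy)//.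
exact: le_trans p1.
Qed.

Let block_le x y : (lp_sum p (block_coord x \- block_coord y)%R
  <= lp_sum p (embedding x \- embedding y)%R)%E.
Proof. by rewrite lp_sum_embedding leeDl// lp_sum_ge0. Qed.

(** Either one block between [a] and [x] covers a quarter of the distance, and its [psi] gives
    [rho D / 4]; or all are shorter, and the ancestor coordinates give [f D / 32]. *)
Lemma embedding_ge_side x y a : apart a x y -> (h a < h x)%N ->
  (((Order.min (rho (h x - h a)) (f (h x - h a)) / 32) `^ p)%R%:E
   <= lp_sum p (embedding x \- embedding y)%R)%E.
Proof.
move=> xy ax; set D := (h x - h a)%N.
have min_ge0 : 0 <= Order.min (rho D) (f D) by rewrite le_min rho_ge0 f_ge0.
have [[u [ux au Du]]|short] := pselect (exists u,
    [/\ anc u x, (h a < h u)%N & (D <= 4 * (h u - h (g (b u))))%N]).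
  have ue := anc_neq ux; have [Wu Wg] := W_below ue.
  apply: le_trans (block_le x y); apply: le_trans (block_coord_ge _ _ (b u)).
  rewrite block_proj_anc// xy//; apply: le_trans (psi_ge Wu Wg).
  rewrite lee_fin; apply: powR_le; first by rewrite divr_ge0.
  have -> : 32 = 4 * 8 :> R by ring.
  rewrite ler_pdivrMr// (le_trans (y := rho D)) ?ge_min ?lexx//.
  apply: (@le_trans _ _ (rho (4 * d u (g (b u)))%N)).
    case: rho_concave => _ [+ _]; apply; rewrite (leq_trans Du)// leq_mul2l/=.
    by rewrite leq_subLR d_sym -d_gate.
  apply: le_trans (concave_fun_mulSn _ _ rho_concave) _.
  by rewrite mulrC ler_wpM2l// ler_peMr//; lra.
have short' u : anc u x -> (h a < h u)%N -> (4 * (h u - h (g (b u))) < D)%N.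
  by move=> ux au; rewrite ltnNge; apply/negP => Du; apply: short; exists u.
(* The first block from [x] has length at least 1, yet less than [D / 4]. *)
have D4 : (4 <= D)%N.
  have [|u [k [ux ku kE]]] := @depth_surj x 0 he; first exact: leq_ltn_trans ax.
  have := anc_leq ux; have /(_ _) := short' u ux; move: ku kE ax; rewrite /D; lia.
rewrite lp_sum_embedding; apply: (@le_trans _ _ (lp_sum p (ancestor_coord x \- ancestor_coord y))).
  apply: le_trans (ancestor_coord_ge he xy (v_ge0 D) short' _).
    rewrite lee_fin (le_trans _ (v_count D4))//; apply: powR_le.
      by rewrite divr_ge0.
    by rewrite ler_pM2r ?invr_gt0// ge_min lexx orbT.
  exact: v_ramp.
by rewrite leeDr// lp_sum_ge0.
Qed.

(** The way from [x] to [y] splits at [a] and [c] into three parts, one of which has at least a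
    third of the length. Subadditivity costs a factor 3, whence [96 = 3 * 32]. *)
Lemma embedding_ge x y :
  (((Order.min (rho (d x y)) (f (d x y)) / 96) `^ p)%R%:E
   <= lp_sum p (embedding x \- embedding y)%R)%E.
Proof.
have [a [c [[ax cy] ac xy yx]]] := meet_exists x y.
have min_ge0 D : 0 <= Order.min (rho D) (f D) by rewrite le_min rho_ge0 f_ge0.
suff [D D3 DE] : exists2 D, (d x y <= 3 * D)%N &
    (((Order.min (rho D) (f D) / 32) `^ p)%R%:E
     <= lp_sum p (embedding x \- embedding y)%R)%E.
  apply: le_trans DE; rewrite lee_fin; apply: powR_le; first by rewrite divr_ge0.
  have sub3 k : concave_fun k -> k (d x y) <= 3 * k D.
    move=> kc; apply: le_trans (concave_fun_mulSn 2 D kc).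
    by case: kc => _ [+ _]; apply.
  have : Order.min (rho (d x y)) (f (d x y)) <= 3 * Order.min (rho D) (f D).
    by rewrite minr_pMr// le_min !ge_min !sub3// orbT.
  lra.
have dxy : (d x y <= (h x - h a) + d a c + (h y - h c))%N.
  have := d_triangle x a y; have := d_triangle a c y; rewrite (d_sym x a).
  by move: ax cy; lia.
have zero : ((0 `^ p)%R%:E <= lp_sum p (embedding x \- embedding y)%R)%E.
  by rewrite powR0 ?lp_sum_ge0// gt_eqF// (lt_le_trans _ p1).
have rhof0 : Order.min (rho 0%N) (f 0%N) / 32 = 0.
  by rewrite rho0 (min_idPl _)// mul0r.
have xD := embedding_ge_side xy; have yD := embedding_ge_side yx.
rewrite lp_sum_sym in yD.
have mid : (((Order.min (rho (d a c)) (f (d a c)) / 32) `^ p)%R%:E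
     <= lp_sum p (embedding x \- embedding y)%R)%E.
  case: ac => [->|[[ae ce] bac pa pc]]; first by rewrite dxx rhof0.
  apply: le_trans (block_le x y); apply: le_trans (block_coord_ge _ _ (b a)).
  rewrite pa pc; have [Wa _] := W_below ae; have [Wc _] := W_below ce.
  rewrite -bac in Wc; apply: le_trans (psi_ge Wa Wc).
  rewrite lee_fin; apply: powR_le; first by rewrite divr_ge0.
  rewrite ler_pdivrMr// (le_trans (y := rho (d a c))) ?ge_min ?lexx//.
  by rewrite ler_peMr//; lra.
have [xle|xgt] := leqP (d x y) (3 * (h x - h a)).
  have [ax0|/xD ?] := leqP (h x) (h a); last by exists (h x - h a)%N.
  by exists 0%N; rewrite ?rhof0//; move: xle ax0; lia.
have [yle|ygt] := leqP (d x y) (3 * (h y - h c)).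
  have [cy0|/yD ?] := leqP (h y) (h c); last by exists (h y - h c)%N.
  by exists 0%N; rewrite ?rhof0//; move: yle cy0; lia.
by exists (d a c) => //; move: dxy xgt ygt; lia.
Qed.

(** * The Lipschitz bound *)

Hypothesis F_double : forall m k, (k <= m)%N -> F m.+1 <= 4 * F (m + k).+1.

Lemma ramp_lip m n k : (m <= n.+1)%N -> (n <= m.+1)%N ->
  `|ramp m k - ramp n k| <= 4 * F (minn m n + k).+1.
Proof.
wlog mn : m n / (m <= n)%N => [hwlog|_ nm].
  move=> mn nm; case/orP: (leq_total m n) => le_mn; first exact: hwlog.
  by rewrite distrC minnC; exact: hwlog.
have F4 i : 0 <= 4 * F i by rewrite mulr_ge0.
have [->|nm'] := eqVneq n m; first by rewrite subrr normr0.
have -> : n = m.+1 by move: nm' mn nm; lia.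
rewrite (minn_idPl (leqnSn m)) /ramp; have [km|mk] := leqP k m; last first.
  by rewrite (big_geq (ltnW mk)) (big_geq mk) subrr normr0.
rewrite big_nat_recr//= opprD addrA subrr add0r normrN ger0_norm//.
exact: F_double.
Qed.

Variable B : R.
Hypothesis F_sum : (\esum_(n in [set: nat]) ((4 * F n.+1) `^ p)%R%:E <= (B `^ p)%R%:E)%E.

(** Passing from [z] to [x] adds at most the ancestor [x] itself, where the ramp has length 0 and
    vanishes. Both ends of an edge can thus be indexed by the ancestors of one [z]. *)
Lemma ancestor_coord_child x z s : x = z \/ x <> e /\ g (b x) = z ->
  ancestor_coord x s =
  if `[< anc s.1 z /\ (s.2 < h s.1 - h (g (b s.1)))%N >] then ramp (h x - h s.1) s.2 else 0.
Proof.
move=> [->//|[xe <-]]; rewrite /ancestor_coord.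
case: (pselect (s.1 = x)) => [sx|sx].
  by rewrite sx subnn /ramp !big_geq// !if_same.
congr (if _ then _ else _); congr asbool; apply: propext; split=> -[ax sl]; split => //.
  by have [|] := (ancE _ xe).1 ax.
by apply/(ancE _ xe); right.
Qed.

(** By [ramp_lip] the coordinate [(u, k)] changes by at most [4 * F (H - h u + k + 1)]. These
    indices are distinct by [depth_inj], so the total is at most the full series. *)
Lemma ancestor_coord_lip x y z :
  x = z \/ x <> e /\ g (b x) = z -> y = z \/ y <> e /\ g (b y) = z ->
  (h x <= (h y).+1)%N -> (h y <= (h x).+1)%N ->
  (lp_sum p (ancestor_coord x \- ancestor_coord y)%R <= (B `^ p)%R%:E)%E.
Proof.
move=> xz yz xy yx; apply: le_trans F_sum.
pose D := [set s : V * nat | anc s.1 z /\ (s.2 < h s.1 - h (g (b s.1)))%N].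
pose H := minn (h x) (h y).
pose idx (s : V * nat) := (H - h s.1 + s.2)%N.
have zH : (h z <= H)%N.
  rewrite leq_min; apply/andP; split.
    by case: xz => [->//|[xe <-]]; exact/ltnW/g_lt.
  by case: yz => [->//|[ye <-]]; exact/ltnW/g_lt.
have idx_inj : {in D &, injective idx}.
  move=> [u k] [w l]; rewrite !inE /D /idx /= => -[uz ku] [wz lw] kl.
  by have [-> ->] := depth_inj uz wz zH ku lw kl.
apply: (@le_trans _ _ (\esum_(s in D) ((4 * F (idx s).+1) `^ p)%R%:E)).
  rewrite [leRHS]esum_mkcond; apply: le_esum => s _ /=.
  have -> : (s \in D) = `[< D s >] by apply/idP/asboolP; rewrite inE.
  rewrite (ancestor_coord_child _ xz) (ancestor_coord_child _ yz) -/(D s).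
  case: asboolP => [[sz sl]|_]; last by rewrite subrr normr0 powR0 ?gt_eqF ?(lt_le_trans _ p1).
  rewrite lee_fin; apply: ge0_ler_powR; rewrite ?nnegrE ?mulr_ge0//.
    exact: le_trans p1.
  have -> : idx s = (minn (h x - h s.1) (h y - h s.1) + s.2)%N.
    by rewrite /idx /H; congr addn; move: (h x) (h y) (h s.1) => hx hy hs; lia.
  by apply: ramp_lip; move: xy yx; lia.
rewrite -(@esum_image _ _ _ D idx (fun n => ((4 * F n.+1) `^ p)%R%:E))//.
rewrite [leRHS](esumID (idx @` D)); last by move=> n _; rewrite lee_fin powR_ge0.
by rewrite setTI leeDl// esum_ge0// => n _; rewrite lee_fin powR_ge0.
Qed.

Variables (adj : V -> V -> Prop) (K : R).
Hypothesis K_gt0 : 0 < K.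
Hypothesis adj_block : forall x y, adj x y ->
  exists j, [/\ W j x, W j y, x = g j \/ x <> e /\ b x = j
                & y = g j \/ y <> e /\ b y = j].
Hypothesis h_adj : forall x y, adj x y -> (h x <= (h y).+1)%N /\ (h y <= (h x).+1)%N.
Hypothesis psi_adj : forall j x y, W j x -> W j y -> adj x y ->
  (lp_sum p (psi (j := j) x \- psi y)%R <= (K `^ p)%R%:E)%E.

(** Only block [j] sees the edge: in any other block both ends project to where the gate of [j]
    does. *)
Lemma embedding_adj x y : adj x y ->
  (lp_sum p (embedding x \- embedding y)%R <= (K `^ p + B `^ p)%R%:E)%E.
Proof.
move=> xy; have [j [jx jy xj yj]] := adj_block xy; have [hx hy] := h_adj xy.
have proj_in z : z = g j \/ z <> e /\ b z = j ->
    block_proj j z = z /\ forall i, i <> j -> block_proj i z = block_proj i (g j).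
  move=> [->|[ze <-]]; first by rewrite block_proj_gate.
  by rewrite block_proj_self//; split => // i; exact: block_proj_other.
have [xx x_other] := proj_in x xj; have [yy y_other] := proj_in y yj.
rewrite lp_sum_embedding EFinD leeD//.
  rewrite (block_coord_eq (j := j)) ?xx ?yy; first exact: psi_adj.
  by move=> i ij; rewrite x_other// y_other.
have child z : z = g j \/ z <> e /\ b z = j -> z = g j \/ z <> e /\ g (b z) = g j.
  by move=> [->|[ze <-]]; [left|right].
exact: ancestor_coord_lip (child _ xj) (child _ yj) hx hy.
Qed.

Definition lipschitz_const : R := (K `^ p + B `^ p) `^ p^-1.

Lemma lipschitz_const_gt0 : 0 < lipschitz_const.
Proof. by rewrite powR_gt0// ltr_pwDl ?powR_gt0 ?powR_ge0. Qed.

(** The length is a successor because [lp_sumD] takes positive bounds. *)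
Lemma embedding_walk x y n : walk adj x y n.+1 ->
  (lp_sum p (embedding x \- embedding y)%R <= ((lipschitz_const * n.+1%:R) `^ p)%R%:E)%E.
Proof.
have C0 := lipschitz_const_gt0.
have step u w : adj u w ->
    (lp_sum p (embedding u \- embedding w)%R <= (lipschitz_const `^ p)%R%:E)%E.
  move=> /embedding_adj; rewrite /lipschitz_const -powRrM mulVf ?powRr1 ?addr_ge0 ?powR_ge0//.
  by rewrite gt_eqF// (lt_le_trans _ p1).
elim: n x => [|n IH] x xy; inversion xy as [|? z ? ? xz zy]; subst.
  by inversion zy; subst; rewrite mulr1; exact: step.
rewrite -[n.+2%:R]natr1 mulrDr mulr1 addrC.
rewrite (@eq_lp_sum _ _ _ _ ((embedding x \- embedding z) \+ (embedding z \- embedding y))).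
  by apply: lp_sumD => //; [rewrite mulr_gt0|exact: step|exact: IH].
by move=> s /=; ring.
Qed.

End embedding.

(** * The slope of the ramps *)

Section profile.
Variables (R : realType) (p : R) (p1 : 1 <= p) (f : nat -> R).
Hypothesis f_concave : concave_fun f.

Let p0 : 0 < p. Proof. exact: lt_le_trans p1. Qed.

Let f_ge0 n : 0 <= f n. Proof. by have [] := f_concave. Qed.

Let pV1 : p^-1 <= 1. Proof. by rewrite invf_le1. Qed.

(** This is [f n / n^(1 + 1/p)], whose power [p] is the summand in [Cp_cond]. *)
Definition profile (n : nat) : R := f n / n%:R * (n%:R^-1) `^ p^-1.

Lemma profile_ge0 n : 0 <= profile n.
Proof. by rewrite mulr_ge0 ?powR_ge0// divr_ge0. Qed.

Lemma profile_antitone m n : (0 < m)%N -> (m <= n)%N -> profile n <= profile m.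
Proof.
move=> m0 mn; have n0 := leq_trans m0 mn.
apply: ler_pM; rewrite ?powR_ge0 ?divr_ge0//; first exact: concave_fun_slope.
apply: ge0_ler_powR; rewrite ?nnegrE ?invr_ge0 ?(ltW p0)//.
by rewrite lef_pV2 ?posrE ?ltr0n// ler_nat.
Qed.

(** As [m + k + 1 <= 2 * (m + 1)], the factors [1 / n] and [n^(-1/p)] each lose at most 2, while [f]
    is non-decreasing. *)
Lemma profile_double m k : (k <= m)%N -> profile m.+1 <= 4 * profile (m + k).+1.
Proof.
move=> km; set M := (m + k).+1.
have inv2 : m.+1%:R^-1 <= 2 * M%:R^-1 :> R.
  rewrite ler_pdivlMr ?ltr0n// mulrC ler_pdivrMr ?ltr0n//.
  by rewrite -natrM ler_nat /M; lia.
rewrite (_ : 4 * profile M = f M * (2 * M%:R^-1) * (2 * M%:R^-1 `^ p^-1)); last first.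
  by rewrite /profile; ring.
apply: ler_pM; rewrite ?powR_ge0 ?divr_ge0//.
  apply: ler_pM => //; case: f_concave => _ [+ _]; apply; rewrite /M; lia.
apply: (@le_trans _ _ ((2 * M%:R^-1) `^ p^-1)).
  by apply: ge0_ler_powR; rewrite ?nnegrE ?mulr_ge0 ?invr_ge0 ?(ltW p0).
rewrite powRM ?invr_ge0// ler_wpM2r ?powR_ge0//.
by rewrite -[leRHS]powRr1// ler_powR// ler1n.
Qed.

Lemma profile_powR n : profile n `^ p = n%:R^-1 * (f n / n%:R) `^ p.
Proof.
rewrite /profile [LHS]powRM ?powR_ge0 ?divr_ge0// -powRrM mulVf ?gt_eqF// powRr1 ?invr_ge0//.
by rewrite mulrC.
Qed.

(** The ramp has [t - k >= D / 4] terms, each at least [profile D]. *)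
Lemma profile_ramp D t k : (t <= D)%N -> (D < 2 * t)%N -> (4 * k < D)%N ->
  D%:R / 4 * profile D <= ramp profile t k.
Proof.
move=> tD Dt kD; have t0 : (0 < t)%N by lia.
apply: (@le_trans _ _ (\sum_(k <= i < t) profile D)).
  rewrite big_const_nat iter_addr_0 -[leRHS]mulr_natl ler_wpM2r ?profile_ge0//.
  by rewrite ler_pdivrMr// -natrM ler_nat; lia.
rewrite /ramp big_nat [leRHS]big_nat; apply: ler_sum => i /andP[_ it].
by apply: profile_antitone => //; exact: leq_trans it tD.
Qed.

(** The power on the right is [(f D / 4)^p / D], and [D %/ 4 >= D / 8] for [D >= 4]; then
    [8^(-p) <= 1 / 8] and [32 = 8 * 4]. *)
Lemma profile_count D : (4 <= D)%N ->
  (f D / 32) `^ p <= (D %/ 4)%:R * (D%:R / 4 * profile D) `^ p.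
Proof.
move=> D4; have D0 : 0 < D%:R :> R by rewrite ltr0n; lia.
have f4 : (D%:R / 4 * profile D) `^ p = D%:R^-1 * (f D / 4) `^ p.
  rewrite [LHS]powRM ?profile_ge0 ?divr_ge0 ?(ltW D0)// profile_powR mulrCA.
  rewrite -powRM ?divr_ge0 ?(ltW D0)//; congr (_ * _ `^ _).
  by field; rewrite gt_eqF.
rewrite f4 mulrA (_ : f D / 32 = 8^-1 * (f D / 4)); last by field.
rewrite [leLHS]powRM ?divr_ge0 ?invr_ge0// ler_wpM2r ?powR_ge0//.
apply: (@le_trans _ _ 8^-1).
  by rewrite -[leRHS]powRr1 ?invr_ge0// ger_powR// invr_gt0 invf_le1// ler1n andbT.
rewrite ler_pdivlMr// mulrC ler_pdivrMr// -natrM ler_nat; lia.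
Qed.

Lemma profile_sum : Cp_cond p f -> exists2 B : R, 0 <= B &
  (\esum_(n in [set: nat]) ((4 * profile n.+1) `^ p)%R%:E <= (B `^ p)%R%:E)%E.
Proof.
pose w n := (n%:R^-1 * (f n / n%:R) `^ p)%:E.
have w0 n : (0 <= w n)%E by rewrite lee_fin mulr_ge0 ?powR_ge0.
move=> [_]; rewrite -[X in (X < _)%E]/(\sum_(1 <= n <oo) w n)%E -nneseries_addn//.
pose u n := w (n + 1)%N; rewrite -[X in (X < _)%E]/(\sum_(n <oo) u n)%E.
have u0 n : (0 <= u n)%E by exact: w0.
move=> u_lty.
have uy : (\sum_(n <oo) u n)%E \is a fin_num.
  by rewrite ge0_fin_numE// nneseries_ge0.
exists ((4 `^ p * fine (\sum_(n <oo) u n)%E) `^ p^-1); first exact: powR_ge0.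
rewrite -powRrM mulVf ?gt_eqF// powRr1 ?mulr_ge0 ?powR_ge0 ?fine_ge0 ?nneseries_ge0//.
rewrite EFinM fineK// -nneseriesZl//.
rewrite nneseries_esumT; last by move=> n; rewrite mule_ge0// lee_fin powR_ge0.
apply: le_esum => n _; rewrite /u addn1 /w -EFinM lee_fin -profile_powR.
by rewrite powRM ?profile_ge0.
Qed.

End profile.

(** * The embedding of a tree-graded graph with a root *)

Section tree_graded_embedding.
Variables (R : realType) (V : choiceType) (I : Type) (adj : V -> V -> Prop).
Variables (Vp : I -> set V) (Ep : I -> V -> V -> Prop) (p : R).
Variables (rho : nat -> R) (X : I -> choiceType) (psi : forall i, V -> X i -> R).
Arguments psi : clear implicits.
Hypotheses (adj_simp : simplicial adj) (adj_conn : graph_connected adj).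
Hypotheses (tg : tree_graded adj Vp Ep) (p1 : 1 <= p) (rho_concave : concave_fun rho).
Hypothesis psi_in_lp : forall i x, Vp i x -> in_lp p (psi i x).
Hypothesis psi_bounds : forall i x y, Vp i x -> Vp i y ->
  rho (gdist adj x y) <= lp_norm p (psi i x \- psi i y) /\
  lp_norm p (psi i x \- psi i y) <= (gdist adj x y)%:R.
Variable e : V.

Let d := gdist adj.
Let h := d e.

Let p0 : 0 < p. Proof. exact: lt_le_trans p1. Qed.

Let rho_ge0 n : 0 <= rho n. Proof. by case: rho_concave. Qed.

Let rho0 : rho 0%N = 0.
Proof.
have [_ [/(_ e)[i ie] _]] := tg; have [+ _] := psi_bounds ie ie.
rewrite gdistxx// => rho_le; apply/eqP; rewrite eq_le rho_ge0 andbT.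
apply: (le_trans rho_le); rewrite /lp_norm lp_sum0// => [|s]; last by rewrite /= subrr.
by rewrite powR0// invr_eq0 gt_eqF.
Qed.

Let J := {classic (I + set V)}.

Let W : J -> set V := block adj Vp.
Let b : V -> J := below adj W e (inr set0).
Let g : J -> V := gate adj W e.

(** An edge in a piece has length at most 1, while the ends of a bridge must be at least [rho 1]
    apart; [rho 1] may exceed 1 if every piece is a single vertex. *)
Let K : R := Order.max 1 (rho 1%N).

Let K_gt0 : 0 < K. Proof. by rewrite lt_max ltr01. Qed.

Definition block_coord_type (j : J) : choiceType :=
  match j with inl i => X i | inr _ => unit end.

(** A bridge has no orientation, so [xget] picks the end that is sent to [K]. *)
Definition block_map (j : J) : V -> block_coord_type j -> R :=
  match j with
  | inl i => psi i
  | inr s => fun x _ => if x == xget e s then K else 0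
  end.

Let he : h e = 0%N. Proof. exact: gdistxx. Qed.

Let W_edge x y : adj x y -> exists j, W j x /\ W j y.
Proof. exact: block_edge. Qed.

Let W_inter (i j : J) x y : W i x -> W j x -> W i y -> W j y -> x <> y -> i = j.
Proof. exact: (@block_inter _ _ _ _ _ adj_simp tg i j x y). Qed.

Let W_gap (j : J) a c u v n : W j a -> W j c -> ~ W j u -> adj a u -> adj v c ->
  walk (fun s t => [/\ adj s t, ~ W j s & ~ W j t]) u v n -> a = c.
Proof. exact: (@block_gap _ _ _ _ _ adj_simp tg j a c u v n). Qed.

Let g_lt x : x <> e -> (h (g (b x)) < h x)%N.
Proof. exact: (gate_lt (inr set0 : J) adj_simp adj_conn W_edge). Qed.

Let W_below x : x <> e -> W (b x) x /\ W (b x) (g (b x)).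
Proof.
move=> xe; have [Wx _] := belowP (inr set0 : J) adj_simp adj_conn W_edge xe.
by split=> //; have [] := gateP adj e Wx.
Qed.

Let d_gate x : x <> e -> h x = (h (g (b x)) + d (g (b x)) x)%N.
Proof.
move=> /W_below[Wx _].
exact: (gate_dist e (inr set0 : J) adj_simp adj_conn W_edge W_inter W_gap Wx).
Qed.

Let h_adj x y : adj x y -> (h x <= (h y).+1)%N /\ (h y <= (h x).+1)%N.
Proof. by move=> xy; split; apply: gdist_adj_le => //; exact: adj_simp.1. Qed.

Let block_map_bridge s x y : W (inr s) x -> W (inr s) y -> x <> y ->
  lp_sum p (block_map (j := inr s) x \- block_map y) = (K `^ p)%:E /\ adj x y.
Proof.
move=> sx sy xy; have [sE adj_xy _] := bridge_ends adj_simp sx sy xy.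
split=> //; rewrite /lp_sum (_ : [set: _] = [set tt]); last first.
  by apply/seteqP; split => -[].
rewrite esum_set1 ?lee_fin ?powR_ge0//=; congr ((_ `^ _)%:E).
have : s (xget e s) by apply: (xgetI e); exact: sx.1.
set z := xget e s; rewrite sE => -[]/= ->.
  by rewrite eqxx; case: eqP => [/esym//|_]; rewrite subr0 ger0_norm// ltW.
by rewrite eqxx; case: eqP => [//|_]; rewrite sub0r normrN ger0_norm// ltW.
Qed.

Let piece_lty i x y : Vp i x -> Vp i y -> (lp_sum p (psi i x \- psi i y)%R < +oo)%E.
Proof. by move=> ix iy; apply: lp_sumB_lty => //; [case: (psi_in_lp ix)|case: (psi_in_lp iy)]. Qed.

Let block_map_adj j x y : W j x -> W j y -> adj x y ->
  (lp_sum p (block_map (j := j) x \- block_map y)%R <= (K `^ p)%R%:E)%E.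
Proof.
case: j => [i|s] jx jy xy; last first.
  have xny : x <> y by move=> xy'; apply: (adj_simp.2 x); rewrite [X in adj _ X]xy'.
  by have [-> _] := block_map_bridge jx jy xny.
apply: lp_sum_le => //; first exact: piece_lty.
have [_ +] := psi_bounds jx jy; move/le_trans; apply.
rewrite (@le_trans _ _ 1) ?le_max ?lexx//.
by rewrite (ler_nat _ _ 1) gdist_adj.
Qed.

Let block_map_ge j x y : W j x -> W j y ->
  ((rho (d x y) `^ p)%R%:E <= lp_sum p (block_map (j := j) x \- block_map y)%R)%E.
Proof.
case: j => [i|s] jx jy.
  by apply: lp_sum_ge => //; have [] := psi_bounds jx jy.
have [->|xy] := pselect (x = y).
  by rewrite [d _ _]gdistxx// rho0 powR0 ?gt_eqF// lp_sum_ge0.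
have [-> adj_xy] := block_map_bridge jx jy xy; rewrite lee_fin.
apply: ge0_ler_powR; rewrite ?nnegrE ?(ltW p0) ?(ltW K_gt0)//.
rewrite le_max; apply/orP; right.
by case: rho_concave => _ [+ _]; apply; rewrite gdist_adj.
Qed.

Let tg_embedding := embedding e h b g block_map.

Lemma tg_embedding_lipschitz F B : (forall n, 0 <= F n) ->
  (forall m k, (k <= m)%N -> F m.+1 <= 4 * F (m + k).+1) ->
  (\esum_(n in [set: nat]) ((4 * F n.+1) `^ p)%R%:E <= (B `^ p)%R%:E)%E ->
  [/\ forall x y, (lp_sum p (tg_embedding F x \- tg_embedding F y)%R < +oo)%E,
      forall x, in_lp p (tg_embedding F x) &
      coarse_le (fun x y => lp_norm p (tg_embedding F x \- tg_embedding F y))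
                (fun x y => (gdist adj x y)%:R)].
Proof.
move=> F0 F2 FB; pose C := lipschitz_const p B K.
have C0 : 0 < C by exact: lipschitz_const_gt0.
have lip x y : (lp_sum p (tg_embedding F x \- tg_embedding F y)%R
    <= ((C * (d x y)%:R) `^ p)%R%:E)%E.
  have := gdist_walk adj_conn x y; rewrite -/(d x y); case: (d x y) => [|n] w.
    inversion w; subst; rewrite lp_sum0 ?lee_fin ?powR_ge0// => s.
    by rewrite /= subrr.
  apply: (embedding_walk g_lt p1 F0 he F2 FB K_gt0 _ h_adj block_map_adj w).
  move=> u v uv.
  exact: (block_edge_below e (inr set0 : J) adj_simp adj_conn W_edge W_inter W_gap uv).
have lty x y : (lp_sum p (tg_embedding F x \- tg_embedding F y)%R < +oo)%E.
  by rewrite (le_lt_trans (lip x y))// ltry.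
split=> // [x|].
  apply: lp_sum_in_lp => //.
  (* The root is sent to 0, so a bound on differences bounds each value. *)
  rewrite (eq_lp_sum _ (_ : _ =1 tg_embedding F x \- tg_embedding F e))//.
  by move=> s; rewrite /= /tg_embedding embedding_root subr0.
exists C => x y; rewrite (le_trans (lp_norm_le p1 _ (lip x y)))//.
  by rewrite mulr_ge0// ltW.
by rewrite lerDl ltW.
Qed.

Let d_triangle x y z : (d x z <= d x y + d y z)%N.
Proof. exact: gdist_triangle. Qed.

Let dxx x : d x x = 0%N. Proof. exact: gdistxx. Qed.

Let d_sym x y : d x y = d y x. Proof. exact: gdist_sym. Qed.

Lemma tree_graded_l1 : p = 1 -> exists (S : choiceType) (phi : V -> S -> R),
  [/\ forall x, in_lp p (phi x),
      coarse_le (fun x y => rho (gdist adj x y)) (fun x y => lp_norm p (phi x \- phi y)) &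
      coarse_le (fun x y => lp_norm p (phi x \- phi y)) (fun x y => (gdist adj x y)%:R)].
Proof.
move=> pE; have F2 (m k : nat) : (k <= m)%N -> 0 <= 4 * 0 :> R by rewrite mulr0.
have F_sum : (\esum_(n in [set: nat]) ((4 * 0) `^ p)%R%:E <= (0 `^ p)%R%:E :> \bar R)%E.
  by rewrite esum1 ?lee_fin ?powR_ge0// => n _; rewrite mulr0 powR0 ?gt_eqF.
(* Zero slope switches the ancestor coordinates off; for [p = 1] the blocks suffice. *)
have [lty in_l lip] := @tg_embedding_lipschitz (fun=> 0) 0 (fun=> lexx _) F2 F_sum.
exists _, (tg_embedding (fun=> 0)); split=> //.
exists 1 => x y; rewrite mul1r (le_trans (y := lp_norm p
  (tg_embedding (fun=> 0) x \- tg_embedding (fun=> 0) y))) ?lerDl//.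
apply: lp_norm_ge => //; rewrite {1}pE powRr1//.
rewrite lp_sum_embedding; apply: le_trans (leeDl _ (lp_sum_ge0 _ _)).
apply: (block_coord_subadd g_lt d_triangle dxx p1 W_below rho_concave rho0) => //.
move=> j u v ju jv; have := block_map_ge ju jv; rewrite {1}pE powRr1//.
Qed.

Lemma tree_graded_lp f : Cp_cond p f -> exists (S : choiceType) (phi : V -> S -> R),
  [/\ forall x, in_lp p (phi x),
      coarse_le (fun x y => Order.min (rho (gdist adj x y)) (f (gdist adj x y)))
                (fun x y => lp_norm p (phi x \- phi y)) &
      coarse_le (fun x y => lp_norm p (phi x \- phi y)) (fun x y => (gdist adj x y)%:R)].
Proof.
move=> fCp; have [fc _] := fCp; have [B _ FB] := profile_sum p1 fc fCp.
pose F := profile p f.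
have [lty in_l lip] := tg_embedding_lipschitz (profile_ge0 p fc) (profile_double p1 fc) FB.
exists _, (tg_embedding F); split => //.
exists 96 => x y; set m := Order.min _ _.
have m0 : 0 <= m by rewrite le_min rho_ge0; case: fc => ->.
have : m / 96 <= lp_norm p (tg_embedding F x \- tg_embedding F y).
  apply: lp_norm_ge => //; first by rewrite divr_ge0.
  apply: (embedding_ge g_lt d_triangle d_gate dxx p1 W_below
    rho_concave rho0 fc _ (profile_ramp p1 fc) (profile_count p1 fc) block_map_ge he d_sym).
  by move=> D; rewrite mulr_ge0 ?divr_ge0// profile_ge0.
by lra.
Qed.

End tree_graded_embedding.

Unset Implicit Arguments.

Theorem theorem4p2 (R : realType) (V I : Type) (adj : V -> V -> Prop)
  (Vp : I -> set V) (Ep : I -> V -> V -> Prop) (p : R)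
  (rho' : nat -> R) (X : I -> choiceType) (psi : forall i, V -> X i -> R) :
  simplicial adj -> graph_connected adj -> tree_graded adj Vp Ep ->
  1 <= p ->
  concave_fun rho' ->
  (forall i x, Vp i x -> in_lp p (psi i x)) ->
  (forall i x y, Vp i x -> Vp i y ->
     rho' (gdist adj x y) <= lp_norm p (psi i x \- psi i y) /\
     lp_norm p (psi i x \- psi i y) <= (gdist adj x y)%:R) ->
  (p = 1 ->
   exists (S : choiceType) (phi : V -> S -> R),
     (forall x, in_lp p (phi x)) /\
     coarse_le (fun x y => rho' (gdist adj x y)) (fun x y => lp_norm p (phi x \- phi y)) /\
     coarse_le (fun x y => lp_norm p (phi x \- phi y)) (fun x y => (gdist adj x y)%:R)) /\
  (1 < p -> forall f : nat -> R, Cp_cond p f ->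
   exists (S : choiceType) (phi : V -> S -> R),
     (forall x, in_lp p (phi x)) /\
     coarse_le (fun x y => Order.min (rho' (gdist adj x y)) (f (gdist adj x y)))
               (fun x y => lp_norm p (phi x \- phi y)) /\
     coarse_le (fun x y => lp_norm p (phi x \- phi y)) (fun x y => (gdist adj x y)%:R)).
Proof.
move=> adj_simp adj_conn tg p1 rho_concave psi_lp psi_bounds.
(* A root must exist; on the empty graph all claims are vacuous. *)
have [[e _]|V0] := pselect (exists e : V, True); last first.
  have noV (x : V) : False by apply: V0; exists x.
  split=> [_|_ f _]; exists unit, (fun _ _ => 0); split=> [x|];
    by [case: (noV x)|split; exists 0 => x; case: (noV x)].
split=> [pE|_ f fCp].
  have [S [phi [in_l lower upper]]] := @tree_graded_l1 R {classic V} I adj Vp Ep p rho' X psi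
    adj_simp adj_conn tg p1 rho_concave psi_lp psi_bounds e pE.
  by exists S, phi.
have [S [phi [in_l lower upper]]] := @tree_graded_lp R {classic V} I adj Vp Ep p rho' X psi
  adj_simp adj_conn tg p1 rho_concave psi_lp psi_bounds e f fCp.
by exists S, phi.
Qed.
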